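(* Let $(C,\phi)$ be a $4k$-dimensional symmetric Poincaré complex over $\mathbb{Z}$. Then $$\sigma(C,\phi)\equiv\mathrm{BK}(H^{2k}(C;\mathbb{Z}_2),\phi,\mathcal{P}_2)\in\mathbb{Z}_8,$$ where the $\mathbb{Z}_2$-valued nonsingular symmetric bilinear form on $H^{2k}(C;\mathbb{Z}_2)$ is the one determined by $\phi$ (i.e. by $\phi_0$) and $\mathcal{P}_2=\mathcal{P}_2(\phi):H^{2k}(C;\mathbb{Z}_2)\to\mathbb{Z}_4$ is its $\mathbb{Z}_4$-valued quadratic enhancement given by the algebraic Pontryagin square of $(C,\phi)$.
   Context: Let $W$ be the standard free $\mathbb{Z}[\mathbb{Z}_2]$-module resolution of $\mathbb{Z}$. For a finite-dimensional chain complex $C$ of f.g. projective $\mathbb{Z}$-modules, write $C^r=\mathrm{Hom}(C_r,\mathbb{Z})$, and let $T\in\mathbb{Z}_2$ act on $C\otimes C\cong\mathrm{Hom}(C^{-*},C)$ by $x\otimes y\mapsto(-1)^{pq}y\otimes x$ ($x\in C_p,y\in C_q$). An $n$-dimensional symmetric structure on $C$ is an $n$-cycle $\phi$ of $\mathrm{Hom}_{\mathbb{Z}[\mathbb{Z}_2]}(W,C\otimes C)$, i.e. a collection of maps $\phi_s:C^{n-r+s}\to C_r$ ($s\ge0$) with $d\phi_s+(-1)^r\phi_sd^*+(-1)^{n+s-1}(\phi_{s-1}+(-1)^sT\phi_{s-1})=0$, $\phi_{-1}=0$. The $n$-dimensional symmetric complex $(C,\phi)$ is Poincaré if $\phi_0:C^{n-*}\to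 C$ is a chain equivalence. For $n=4k$, $\sigma(C,\phi)\in\mathbb{Z}$ is the signature of the nonsingular symmetric form $\phi_0$ on $H^{2k}(C)/\mathrm{torsion}$. With $\mathbb{Z}_2$ coefficients $\phi_0$ gives a nonsingular symmetric form on $H^{2k}(C;\mathbb{Z}_2)$. Algebraic Pontryagin square: an element of $H^{2k}(C;\mathbb{Z}_2)$ is represented by $(u,v)$ with $v\in C^{2k}$, $u\in C^{2k+1}$, $d^*v=2u$, $d^*u=0$, and $\mathcal{P}_2(\phi)(u,v)=\phi_0(v,v)+2\phi_1(v,u)\in\mathbb{Z}_4$, where $\phi_s(a,b)$ denotes the evaluation of $a\otimes b$ on $\phi_s\in(C\otimes C)_{4k+s}$. For a nonsingular symmetric form $(V,\lambda)$ over $\mathbb{Z}_2$ with a function $q:V\to\mathbb{Z}_4$ satisfying $q(x+y)=q(x)+q(y)+2\lambda(x,y)$, the Brown-Kervaire invariant $\mathrm{BK}(V,\lambda,q)\in\mathbb{Z}_8$ is defined by $\sum_{x\in V}i^{q(x)}=\sqrt2^{\,\dim V}e^{2\pi i\,\mathrm{BK}(V,\lambda,q)/8}$. *)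

(* Defs.v *)
From HB Require Import structures.
From mathcomp Require Import all_boot all_order all_algebra.
From mathcomp Require Import generic_quotient ring_quotient.
From mathcomp Require Import boolp classical_sets functions fsbigop reals trigo.
From mathcomp Require Import complex ring lra zify.

Set Implicit Arguments.
Unset Strict Implicit.
Unset Printing Implicit Defensive.

Import Order.TTheory GRing.Theory Num.Theory.
Local Open Scope ring_scope.
Local Open Scope quotient_scope.

Section HomZmodule.
Variables (U V : zmodType).
Local Notation hom := {additive U -> V}.
Implicit Types f g h : hom.

HB.instance Definition _ := gen_eqMixin hom.
HB.instance Definition _ := gen_choiceMixin hom.

Lemma homP f g : f =1 g -> f = g.
Proof.
case: f g => [f [[fM]]] [g [[gM]]] /= /funext efg; move: fM gM.
by rewrite efg => fM gM; rewrite (Prop_irrelevance fM gM).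
Qed.

Let hzero : hom := \0.
Let hopp f : hom := \- f.
Let hadd f g : hom := f \+ g.
Let haddA : associative hadd.
Proof. by move=> f g h; apply/homP => x /=; rewrite addrA. Qed.
Let haddC : commutative hadd.
Proof. by move=> f g; apply/homP => x /=; rewrite addrC. Qed.
Let hadd0 : left_id hzero hadd.
Proof. by move=> f; apply/homP => x /=; rewrite add0r. Qed.
Let haddN : left_inverse hzero hopp hadd.
Proof. by move=> f; apply/homP => x /=; rewrite addNr. Qed.

HB.instance Definition _ :=
  GRing.isZmodule.Build hom haddA haddC hadd0 haddN.

Lemma hom0E x : (0 : hom) x = 0. Proof. by []. Qed.
Lemma homDE f g x : (f + g) x = f x + g x. Proof. by []. Qed.
Lemma homNE f x : (- f) x = - f x. Proof. by []. Qed.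
End HomZmodule.

Section HomLmodule.
Variables (R : pzRingType) (U : zmodType) (V : lmodType R).
Local Notation hom := {additive U -> V}.
Implicit Types (f g : hom) (a b : R).

Let hscale_fun a f x : V := a *: f x.
Let hscale_additive a f : nmod_morphism (hscale_fun a f).
Proof.
by split=> [|x y]; rewrite /hscale_fun ?raddf0 ?scaler0// raddfD scalerDr.
Qed.
Let hscale a f : hom :=
  HB.pack_for hom (hscale_fun a f)
    (GRing.isNmodMorphism.Build U V _ (hscale_additive a f)).
Let hscaleA a b f : hscale a (hscale b f) = hscale (a * b) f.
Proof. by apply/homP => x; apply: scalerA. Qed.
Let hscale1 : left_id 1 hscale.
Proof. by move=> f; apply/homP => x; apply: scale1r. Qed.
Let hscaleDr : right_distributive hscale +%R.
Proof. by move=> a f g; apply/homP => x; apply: scalerDr. Qed.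
Let hscaleDl f : {morph hscale^~ f : a b / a + b}.
Proof. by move=> a b; apply/homP => x; apply: scalerDl. Qed.

HB.instance Definition _ :=
  GRing.Zmodule_isLmodule.Build R hom hscaleA hscale1 hscaleDr hscaleDl.

Lemma homZE a f x : (a *: f) x = a *: f x. Proof. by []. Qed.
End HomLmodule.

Section QuotientModule.
Variables (R : pzRingType) (M : lmodType R) (N : submodClosed M).

Let N_oppr : oppr_closed N.
Proof. by move=> x Nx; rewrite -scaleN1r rpredZ. Qed.
Definition lquot_zmod : zmodClosed M :=
  HB.pack_for (zmodClosed M) (N : {pred M})
    (GRing.isAddClosed.Build M N (rpred0D N))
    (GRing.isOppClosed.Build M N N_oppr).
Definition lquot := Quotient.quot lquot_zmod.
HB.instance Definition _ := GRing.Zmodule.on lquot.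
HB.instance Definition _ := EqQuotient.on lquot.

Let qscale (a : R) (x : lquot) : lquot := \pi_lquot (a *: repr x).
Let pi_qscale a (x : M) : \pi_lquot (a *: x) = qscale a (\pi_lquot x).
Proof.
apply/eqP; rewrite /qscale -[_ == _](Quotient.idealrBE lquot_zmod) -scalerBr.
have Nx : x - repr (\pi_lquot x) \in N.
  by rewrite [_ \in _](Quotient.idealrBE lquot_zmod) reprK.
exact: (rpredZ a Nx).
Qed.
Let piD (x y : M) : \pi_lquot (x + y) = \pi_lquot x + \pi_lquot y.
Proof. exact: (raddfD (\pi_lquot : {additive M -> lquot})). Qed.
Let piK (x : lquot) : exists y, x = \pi_lquot y.
Proof. by exists (repr x); rewrite reprK. Qed.
Let qscaleA a b x : qscale a (qscale b x) = qscale (a * b) x.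
Proof. by have [y ->] := piK x; rewrite -!pi_qscale scalerA. Qed.
Let qscale1 : left_id 1 qscale.
Proof. by move=> x; have [y ->] := piK x; rewrite -pi_qscale scale1r. Qed.
Let qscaleDr : right_distributive qscale +%R.
Proof.
move=> a x x'; have [[y ->] [y' ->]] := (piK x, piK x').
by rewrite -piD -!pi_qscale -piD scalerDr.
Qed.
Let qscaleDl x : {morph qscale^~ x : a b / a + b}.
Proof.
by move=> a b; have [y ->] := piK x; rewrite -!pi_qscale -piD scalerDl.
Qed.

HB.instance Definition _ :=
  GRing.Zmodule_isLmodule.Build R lquot qscaleA qscale1 qscaleDr qscaleDl.

Lemma lquot_eqP (x y : M) :
  reflect (\pi_lquot x = \pi_lquot y) (x - y \in N).
Proof.
by rewrite [_ \in N](Quotient.idealrBE lquot_zmod x y); apply: eqP.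
Qed.

End QuotientModule.

Section Torsion.
Variable M : lmodType int.

Definition torsion : {pred M} :=
  [pred x | `[< exists2 m : int, m != 0 & m *: x = 0 >]].

Let torsion_submod : submod_closed torsion.
Proof.
split=> [|a x y /asboolP[m m0 mx] /asboolP[p p0 py]]; apply/asboolP.
  by exists 1 => //; rewrite scaler0.
exists (m * p); first by rewrite mulf_neq0.
rewrite scalerDr scalerA -mulrA [m * (p * a)]mulrC -[p * a * m *: x]scalerA.
by rewrite mx scaler0 add0r -scalerA py scaler0.
Qed.
HB.instance Definition _ := GRing.isSubmodClosed.Build int M torsion
  torsion_submod.

Definition mod_torsion := lquot torsion.
HB.instance Definition _ := GRing.Lmodule.on mod_torsion.
End Torsion.

(* Complexes are graded by all of [int].  The differential is indexed by its
   source and its target, so that no transport along [(r + 1) - 1 = r] is ever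
   needed; only [dif (r + 1) r] can be nonzero. *)
Record chain_complex := ChainComplex {
  obj :> int -> zmodType;
  dif : forall i j : int, {additive obj i -> obj j};
  dif_shape : forall i j : int, i != j + 1 -> forall x, dif i j x = 0;
  dif_dif : forall (i j k : int) (x : obj i), dif j k (dif i j x) = 0
}.

(* A finitely generated projective Z-module is a direct summand of some Z^n *)
Definition fg_projective (V : zmodType) : Prop :=
  exists (n : nat) (i : {additive V -> 'rV[int]_n})
         (p : {additive 'rV[int]_n -> V}), cancel i p.

Definition finite_dimensional (C : chain_complex) : Prop :=
  exists N : nat, forall r : int, N%:Z < `|r| -> forall x : C r, x = 0.

(* Degree-0 maps of graded modules, not required to commute with differentials *)
Definition gmap (C D : chain_complex) := forall r : int, {additive C r -> D r}.

Definition is_chain_map (C D : chain_complex) (f : gmap C D) : Prop :=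
  forall (i j : int) (x : C i), f j (dif C i j x) = dif D i j (f i x).

Definition chain_homotopic (C D : chain_complex) (f g : gmap C D) : Prop :=
  exists h : forall i j : int, {additive C i -> D j},
  forall (r : int) (x : C r),
    f r x - g r x = dif D (r + 1) r (h r (r + 1) x)
                    + h (r - 1) r (dif C r (r - 1) x).

Definition gid (C : chain_complex) : gmap C C := fun r => idfun.
Definition gcomp (C D E : chain_complex) (g : gmap D E) (f : gmap C D) :
  gmap C E := fun r => g r \o f r.

Definition chain_equivalence (C D : chain_complex) (f : gmap C D) : Prop :=
  is_chain_map f /\
  exists g : gmap D C, [/\ is_chain_map g,
    chain_homotopic (gcomp g f) (gid C) & chain_homotopic (gcomp f g) (gid D)].

Notation cochain C A r := {additive obj C r -> A^o}.

Section Cohomology.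
Variables (C : chain_complex) (A : comNzRingType).

(* [codif i j] is the dual d^* : Hom(C_i, A) -> Hom(C_j, A), without sign *)
Definition codif (i j : int) (f : cochain C A i) : cochain C A j :=
  f \o dif C j i.

Let codifP i j a (f g : cochain C A i) :
  codif j (a *: f + g) = a *: codif j f + codif j g.
Proof. exact/homP. Qed.
HB.instance Definition _ i j := GRing.isLinear.Build A
  (cochain C A i) (cochain C A j) *:%R (@codif i j) (@codifP i j).

Definition cocycle_pred (r : int) : {pred cochain C A r} :=
  [pred f | codif (r + 1) f == 0].
Let cocycle_submod r : submod_closed (@cocycle_pred r).
Proof.
split=> [|a f g /eqP f0 /eqP g0]; first by rewrite inE raddf0.
by rewrite inE codifP f0 g0 scaler0 addr0.
Qed.
HB.instance Definition _ r := GRing.isSubmodClosed.Build A (cochain C A r)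
  (@cocycle_pred r) (cocycle_submod r).

Record cocycle (r : int) := Cocycle {
  cocycle_val :> cochain C A r;
  cocycleP : cocycle_val \in @cocycle_pred r }.
HB.instance Definition _ r := [isSub for @cocycle_val r].
HB.instance Definition _ r := [Choice of cocycle r by <:].
HB.instance Definition _ r := [SubChoice_isSubLmodule of cocycle r by <:].

Definition coboundary (r : int) : {pred cocycle r} :=
  [pred f | `[< exists g : cochain C A (r - 1),
                  cocycle_val f = codif r g >]].
Let coboundary_submod r : submod_closed (@coboundary r).
Proof.
split=> [|a f g /asboolP[f' ff'] /asboolP[g' gg']]; apply/asboolP.
  by exists 0; rewrite raddf0.
by exists (a *: f' + g'); rewrite codifP -ff' -gg'.
Qed.
HB.instance Definition _ r := GRing.isSubmodClosed.Build A (cocycle r)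
  (@coboundary r) (coboundary_submod r).

Definition cohomology (r : int) := lquot (@coboundary r).
HB.instance Definition _ r := GRing.Lmodule.on (cohomology r).
HB.instance Definition _ r := EqQuotient.on (cohomology r).

Definition cohom_class (r : int) (f : cocycle r) : cohomology r :=
  \pi_(cohomology r) f.
End Cohomology.

(* (C^{n-*})_r = C^{n-r}, with differential (-1)^r d^* : C^{n-r} -> C^{n-r+1} *)
Section DualComplex.
Variables (n : int) (C : chain_complex).

Definition dual_obj (r : int) : zmodType := cochain C int (n - r).
Definition dual_dif (i j : int) : {additive dual_obj i -> dual_obj j} :=
  *:%R ((-1) ^ i : int) \o @codif C int (n - i) (n - j).

Let dual_dif_shape (i j : int) :
  i != j + 1 -> forall f, dual_dif i j f = 0.
Proof.
move=> ij f; apply/homP => x; rewrite -[LHS]/(_ *: f (dif C _ _ x)).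
by rewrite dif_shape ?raddf0 ?scaler0//; apply: contra ij => /eqP ij;
   apply/eqP; lia.
Qed.
Let dual_dif_dif (i j k : int) (f : dual_obj i) :
  dual_dif j k (dual_dif i j f) = 0.
Proof.
apply/homP => x; rewrite -[LHS]/(_ *: (_ *: f (dif C _ _ (dif C _ _ x)))).
by rewrite dif_dif raddf0 !scaler0.
Qed.
Definition dual_complex : chain_complex :=
  ChainComplex dual_dif_shape dual_dif_dif.
End DualComplex.

(* A chain of C ⊗ C, through the isomorphism of C_p ⊗ C_q with Hom(C^p, C_q)
   sending x ⊗ y to the map a |-> a(x) y *)
Definition tensor_chain (C : chain_complex) : Type :=
  forall p q : int, {additive cochain C int p -> C q}.

(* The evaluation of a ⊗ b on a chain of C ⊗ C; as C_q is finitely generated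
   projective in the applications, these values determine the chain. *)
Definition tensor_ev (C : chain_complex) (t : tensor_chain C) (p q : int)
  (a : cochain C int p) (b : cochain C int q) : int := b (t p q a).

(* The evaluation of a ⊗ b on T t, where T (x ⊗ y) = (-1)^{pq} y ⊗ x for x in
   C_p and y in C_q *)
Definition transpose_ev (C : chain_complex) (t : tensor_chain C) (p q : int)
  (a : cochain C int p) (b : cochain C int q) : int :=
  (-1) ^ (p * q) * tensor_ev t b a.

Section Symmetric.
Variables (n : int) (C : chain_complex).

(* phi_{s-1} + (-1)^s T phi_{s-1}, with phi_{-1} = 0 *)
Definition sym_previous (phi : nat -> tensor_chain C) (s : nat) (p q : int)
  (a : cochain C int p) (b : cochain C int q) : int :=
  if s is s'.+1 then
    tensor_ev (phi s') a b + (-1) ^ s%:Z * transpose_ev (phi s') a b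
  else 0.

(* [sym_cycle] is the evaluation on a ⊗ b of
     d phi_s + (-1)^r phi_s d^*
       + (-1)^(n+s-1) (phi_{s-1} + (-1)^s T phi_{s-1}) = 0 : C^{n-r+s-1} -> C_r.
   [sym s p q] is phi_s : C^p -> C_q, meaningful for p = n - q + s only. *)
Record symmetric_structure := SymmetricStructure {
  sym :> nat -> tensor_chain C;
  sym_shape : forall (s : nat) (p q : int), p + q != n + s%:Z ->
    forall a, sym s p q a = 0;
  sym_cycle : forall (s : nat) (p r : int), p + r = n + s%:Z - 1 ->
    forall (a : cochain C int p) (b : cochain C int r),
      b (dif C (r + 1) r (sym s p (r + 1) a))
      + (-1) ^ r * b (sym s (p + 1) r (codif (p + 1) a))
      + (-1) ^ (n + s%:Z - 1) * sym_previous sym s a b = 0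
}.

Definition duality_map (phi : symmetric_structure) : gmap (dual_complex n C) C :=
  fun r => phi 0 (n - r) r.

Definition poincare (phi : symmetric_structure) : Prop :=
  chain_equivalence (duality_map phi).
End Symmetric.

Definition is_basis (R : pzRingType) (M : lmodType R) (n : nat)
  (e : 'I_n -> M) : Prop :=
  bijective (fun c : 'rV[R]_n => \sum_i c 0 i *: e i).

Definition nonsingular_symmetric (R : comNzRingType) (V : lmodType R)
  (lambda : V -> V -> R) : Prop :=
  [/\ forall x y, lambda x y = lambda y x,
      forall x, linear (lambda x : V -> R^o)
    & forall f : {linear V -> R^o}, exists! x, lambda x = f].

(* The signature of a symmetric form over Z, read off from a diagonalization
   over Q of its matrix in a Z-basis; by the law of inertia the result does not
   depend on the choices. *)
Definition is_signature (F : lmodType int) (lambda : F -> F -> int)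
  (sigma : int) : Prop :=
  exists (n : nat) (e : 'I_n -> F) (P : 'M[rat]_n),
    let D := P^T *m (\matrix_(i, j) (lambda (e i) (e j))%:~R) *m P in
    [/\ is_basis e, P \in unitmx, is_diag_mx D & sigma = \sum_i sgz (D i i)].

Definition form_signature (F : lmodType int) (lambda : F -> F -> int) : int :=
  xget 0 [set sigma | is_signature lambda sigma]%classic.

Definition quadratic_enhancement (V : lmodType 'F_2) (lambda : V -> V -> 'F_2)
  (q : V -> 'Z_4) : Prop :=
  forall x y, q (x + y) = q x + q y + (lambda x y : nat)%:R *+ 2.

Definition cis (R : realType) (t : R) : R[i] := (cos t +i* sin t)%C.

Definition is_brown_kervaire (R : realType) (V : lmodType 'F_2)
  (lambda : V -> V -> 'F_2) (q : V -> 'Z_4) (m : 'Z_8) : Prop :=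
  [/\ nonsingular_symmetric lambda, quadratic_enhancement lambda q
    & exists (n : nat) (e : 'I_n -> V), is_basis e /\
        \sum_(x \in [set: V]%classic) ('i%C : R[i]) ^+ (q x : nat)
        = (Num.sqrt (2 : R))%:C%C ^+ n * cis (2 * pi * (m : nat)%:R / 8)].

(* The integers mod 8 are represented by 0, ..., 7 in the exponent above; at
   most one of them qualifies. *)
Definition BK (R : realType) (V : lmodType 'F_2) (lambda : V -> V -> 'F_2)
  (q : V -> 'Z_4) : 'Z_8 :=
  xget 0 [set m | is_brown_kervaire R lambda q m]%classic.

Section Middle.
Variables (C : chain_complex) (k : nat).
Variable phi : symmetric_structure (4 * k%:Z) C.
Let m : int := 2 * k%:Z.

Definition H_free := mod_torsion (cohomology C int m).
Definition H_mod2 := cohomology C 'F_2 m.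
HB.instance Definition _ := GRing.Lmodule.on H_free.
HB.instance Definition _ := GRing.Lmodule.on H_mod2.

(* [free_rep] and [mod2_rep] choose cochain representatives; the forms and the
   Pontryagin square below do not depend on this choice when the C_r are
   finitely generated projective. *)
Definition free_rep (x : H_free) : cochain C int m :=
  cocycle_val (repr (repr x : cohomology C int m)).

Definition free_form (x y : H_free) : int :=
  tensor_ev (phi 0) (free_rep x) (free_rep y).

Definition signature : int := form_signature free_form.

(* (u, v) represents x when v is a lift to Z of a cocycle of class x *)
Definition represents (x : H_mod2)
  (uv : cochain C int (m + 1) * cochain C int m) : Prop :=
  [/\ codif (m + 1) uv.2 = uv.1 *+ 2, codif (m + 1 + 1) uv.1 = 0
    & exists c : cocycle C 'F_2 m,
        cohom_class c = x /\ forall y, c y = (uv.2 y)%:~R].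

Definition mod2_rep (x : H_mod2) : cochain C int (m + 1) * cochain C int m :=
  xget (0, 0) [set uv | represents x uv]%classic.

Definition mod2_form (x y : H_mod2) : 'F_2 :=
  (tensor_ev (phi 0) (mod2_rep x).2 (mod2_rep y).2)%:~R.

Definition pontryagin_square (x : H_mod2) : 'Z_4 :=
  let: (u, v) := mod2_rep x in
  (tensor_ev (phi 0) v v)%:~R + (tensor_ev (phi 1) v u)%:~R *+ 2.
End Middle.

(* Main.v *)
From HB Require Import structures.
Require Import Defs.
From mathcomp Require Import all_boot all_order all_algebra reals.
From mathcomp Require Import boolp classical_sets fsbigop trigo.
From mathcomp Require Import complex ring lra zify.

Set Implicit Arguments.
Unset Strict Implicit.
Unset Printing Implicit Defensive.

Import Order.TTheory GRing.Theory Num.Theory.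
Local Open Scope ring_scope.

(** Write [lambda] for the form on V = H^2k(C; Z_2) and [q] for the Pontryagin
    square.  Since [q] refines the nonsingular form [lambda], the Gauss sum of
    i^q over V has absolute value sqrt(2)^(dim V) ([i_q_norm]); what has to be
    found is its argument, pi sigma / 4 ([brown_sum_phase]).

    On cochains, the Pontryagin square is the integral quadratic form
    Q(v) = phi_0(v, v) + phi_1(v, d^* v) ([pontryagin_form]).  The cycle
    relations of phi in degrees s = 0, 1, 2 show that, modulo 4, it is quadratic
    over phi_0 and vanishes on the coboundaries modulo 2, so that [lambda] and [q]
    can be computed on any lifts ([mod2_formE], [pontryagin_squareE]).

    Duality enters through three statements on cochains: [lambda] is
    nondegenerate ([mod2_nondegenerate]); a class orthogonal to the torsion
    cocycles is the reduction of an integral cocycle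
    ([torsion_orthogonal_integral]); phi_0 is unimodular on
    F = H^2k(C) / torsion ([phi0_unimodular]).  In each of them the Smith normal
    form of a differential ([smith_coordinates]) reveals that a chain of the form
    phi_0 v is a boundary in the appropriate sense, and the inverse chain
    equivalence ([poincare_inverse]) carries this back to the cochain v.

    Let K be the set of reductions of the torsion cocycles of degree 2k.  The
    function q vanishes on K and the orthogonal of K is the set of reductions of
    integral cocycles.  Summing over the cosets of K therefore leaves the sum of
    i^q over the reductions of integral cocycles ([isotropic_sum]), where
    i^q = i^(x B x^T) only depends on the class x in F, B being the Gram matrix of
    F.  This is the point where the signature is met, and what remains is an
    assertion on unimodular symmetric integral matrices, a case of the theorem
    of Milgram and van der Blij ([unimodular_gauss_sum]).  An integral
    matrix P, invertible over the rationals, diagonalizes B, with entries d_j;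
    the argument with K, used again in the discriminant group of the diagonal
    form with entries 2 d_j, relates the sum for B to the product of the sums of
    exp(pi i x^2 / (2 d_j)) over x modulo 2 d_j.

    Each of these has argument sgn(d_j) pi / 4 ([gauss_sum_phase]).  Following
    Gauss, a summation formula for q-binomial coefficients turns the sum into a
    finite product ([gauss_product]), whose factors can be grouped into positive
    multiples of roots of unity. *)

(** * The q-binomial form of Gauss's sum *)

Section QBinomial.
Variables (A : comNzRingType) (q : A).

Fixpoint qbin (m j : nat) : A :=
  match m, j with
  | _, 0%N => 1
  | 0%N, _.+1 => 0
  | m'.+1, j'.+1 => qbin m' j' + q ^+ j'.+1 * qbin m' j'.+1
  end.

Lemma qbin0 m : qbin m 0 = 1. Proof. by case: m. Qed.

Lemma qbin_small m j : (m < j)%N -> qbin m j = 0.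
Proof.
elim: m j => [|m IH] [|j] //= mj.
by rewrite !IH ?mulr0 ?addr0// ltnW.
Qed.

(** The q-analogue of (j + 1) C(m, j + 1) = (m - j) C(m, j).  In this form,
    without denominators, it also holds at roots of unity; it yields both the
    second Pascal rule and the values of [qbin] there. *)
Lemma qbin_absorb m j : (j <= m)%N ->
  (1 - q ^+ j.+1) * qbin m j.+1 = (1 - q ^+ (m - j)) * qbin m j.
Proof.
elim: m j => [|m IH] [|j] //.
- by rewrite subnn expr0 subrr mul0r /= mulr0.
- move=> _; have := IH 0%N isT; rewrite !subn0 !qbin0 => e.
  rewrite expr1 in e; rewrite [qbin m.+1 1]/= qbin0 expr1 [q ^+ m.+1]exprS.
  by rewrite mulrDr mulrCA e; ring.
move=> jm; rewrite subSS [qbin m.+1 j.+1]/= [qbin m.+1 j.+2]/=.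
rewrite [RHS]mulrDr [in RHS]mulrCA -IH// [LHS]mulrDr [in LHS]mulrCA.
have [jm'|] := ltnP j m; last first.
  move=> mj; have -> : j = m by apply/eqP; rewrite eqn_leq -ltnS jm mj.
  by rewrite subnn !(@qbin_small m)//; ring.
rewrite (IH j.+1)// -[(m - j)%N](@subnSK j m)//.
by rewrite !exprS; ring.
Qed.

Lemma qbinSr m j : (j <= m)%N ->
  qbin m.+1 j.+1 = q ^+ (m - j) * qbin m j + qbin m j.+1.
Proof.
move=> jm /=; have /eqP := qbin_absorb jm.
rewrite !mulrBl !mul1r subr_eq => /eqP e; rewrite [X in _ = _ + X]e; ring.
Qed.

Lemma qbinn m : qbin m m = 1.
Proof. by elim: m => //= m ->; rewrite qbin_small// mulr0 addr0. Qed.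

Lemma qbin_sym m j : (j <= m)%N -> qbin m (m - j) = qbin m j.
Proof.
elim: m j => [|m IH] [|j] //; first by rewrite subn0 qbinn qbin0.
rewrite ltnS subSS leq_eqVlt => /predU1P[->|jm].
  by rewrite subnn qbinn.
rewrite -[(m - j)%N](@subnSK j m)// qbinSr ?leq_subr//.
rewrite subKn// IH// subnSK// IH ?(ltnW jm)//=; ring.
Qed.
End QBinomial.

(** By the second Pascal rule, going from m to m + 1 adds the sum of the
    t^(2m + 1 - j) [qbin m j], which by symmetry is t^(m + 1) times the sum
    for m. *)
Lemma qbin_sum (A : comNzRingType) (t : A) (m : nat) :
  \sum_(j < m.+1) t ^+ j * qbin (t ^+ 2) m j = \prod_(i < m) (1 + t ^+ i.+1).
Proof.
elim: m => [|m IH]; first by rewrite big_ord_recl !big_ord0 addr0 mulr1.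
rewrite [RHS]big_ord_recr /= -IH.
rewrite (eq_bigr (fun j : 'I_m.+2 => t ^+ j * qbin (t ^+ 2) m j
    + (if (0 < j)%N then t ^+ (m.+1 + (m - j.-1)) * qbin (t ^+ 2) m (m - j.-1) else 0)));
    last first.
  move=> [[|j] jm] _ /=; first by rewrite qbin0 addr0.
  rewrite -[qbin _ _ _ + _]/(qbin (t ^+ 2) m.+1 j.+1) qbinSr// qbin_sym//.
  rewrite mulrDr addrC mulrA -exprM -exprD; congr (_ + t ^+ _ * _).
  by move: jm; rewrite ltnS; lia.
rewrite big_split /= big_ord_recr /= qbin_small// mulr0 addr0 mulrDr mulr1.
congr (_ + _); rewrite big_ord_recl /= add0r mulr_suml (reindex_inj rev_ord_inj).
apply: eq_bigr => j _ /=; rewrite add0n subSS subKn -1?ltnS//.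
by rewrite exprD; ring.
Qed.

(** When q has order N + 1, 1 - q^(N - j) = - q^(N - j) (1 - q^(j + 1)), so by
    [qbin_absorb] consecutive coefficients differ by a sign and a power of q. *)
Lemma qbin_root (A : idomainType) (q : A) (N j : nat) :
  N.+1.-primitive_root q -> (j <= N)%N ->
  q ^+ ('C(j.+1, 2)) * qbin q N j = (-1) ^+ j.
Proof.
move=> qN; elim: j => [|j IH] jN; first by rewrite bin_small// qbin0 mulr1.
have /(congr1 ( *%R (q ^+ 'C(j.+1, 2)))) := qbin_absorb q (ltnW jN).
rewrite mulrCA [RHS]mulrCA IH 1?ltnW// => e.
have q1 : 1 - q ^+ j.+1 != 0.
  rewrite subr_eq0 eq_sym -(prim_order_dvd qN); apply/negP => /dvdn_leq.
  by move=> /(_ isT); lia.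
apply: (mulfI q1); rewrite binS bin1 exprD.
transitivity (q ^+ j.+1 * ((1 - q ^+ j.+1) * (q ^+ 'C(j.+1, 2) * qbin q N j.+1))).
  by ring.
rewrite e mulrA mulrBr mulr1 -exprD.
have -> : (j.+1 + (N - j) = N.+1)%N by lia.
by rewrite (prim_expr_order qN) [(-1) ^+ j.+1]exprS; ring.
Qed.

(** The terms of [qbin_sum] for m = N are the w^(j^2) when w = - 1 / t.  Unlike the
    sum, the product displays its argument; this works for all orders N + 1, even
    or odd. *)
Lemma gauss_product (A : idomainType) (t w : A) (N : nat) :
  t * w = -1 -> N.+1.-primitive_root (t ^+ 2) ->
  \sum_(j < N.+1) w ^+ (j ^ 2) = \prod_(i < N) (1 + t ^+ i.+1).
Proof.
move=> tw tN; rewrite -qbin_sum; apply: eq_bigr => j _.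
have jN : (j <= N)%N by rewrite -ltnS.
have := qbin_root tN jN; set b := qbin _ _ _ => e.
have bE : ('C(j.+1, 2) * 2 = j * j + j)%N.
  by rewrite mulnC -(mul_bin_diag j.+1 1) bin1 /=; lia.
rewrite -exprM mulnC bE in e.
have tw1 : (t * w) ^+ (j * j + j) = 1.
  by rewrite tw -mulnSr exprM -exprM -signr_odd oddM /= andbN.
rewrite -[b]mul1r -tw1 exprMn.
transitivity (t ^+ j * w ^+ (j * j + j) * (t ^+ (j * j + j) * b)); last by ring.
rewrite e.
transitivity ((t * w) ^+ j * (-1) ^+ j * w ^+ (j * j)); last first.
  by rewrite exprD exprMn; ring.
by rewrite tw -expr2 sqrr_sign mul1r mulnn.
Qed.

(** * Complex exponentials and arguments *)

Section Cis.
Variable R : realType.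
Implicit Types x y : R.

Lemma cisD x y : cis (x + y) = cis x * cis y.
Proof.
apply/eqP; rewrite /cis eq_complex /= cosD sinD.
by apply/andP; split; apply/eqP; ring.
Qed.

Lemma cis0 : cis (0 : R) = 1.
Proof. by rewrite /cis cos0 sin0. Qed.

Lemma cisN x : cis (- x) = (cis x)^*%C.
Proof. by rewrite /cis cosN sinN. Qed.

Lemma cisMn x n : cis (x *+ n) = cis x ^+ n.
Proof. by elim: n => [|n IH]; rewrite ?cis0// mulrS exprS cisD IH. Qed.

Lemma cis_pihalf : cis (pi / 2 : R) = 'i%C.
Proof. by rewrite /cis cos_pihalf sin_pihalf. Qed.

Lemma cis_pi : cis (pi : R) = -1.
Proof. by rewrite /cis cospi sinpi; apply/eqP; rewrite eq_complex /= oppr0 !eqxx. Qed.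

Lemma cis_2pi : cis (2 * pi : R) = 1.
Proof. by rewrite mulr_natl mulr2n cisD cis_pi mulrNN mulr1. Qed.

Lemma cisMcisN x : cis x * cis (- x) = 1.
Proof. by rewrite -cisD subrr cis0. Qed.

Lemma cis_neq0 x : cis x != 0.
Proof.
by apply/eqP => e; have := cisMcisN x; rewrite e mul0r => /eqP; rewrite eq_sym oner_eq0.
Qed.

Lemma cisV x : (cis x)^-1 = cis (- x).
Proof. by apply: (mulfI (cis_neq0 x)); rewrite divff ?cis_neq0// cisMcisN. Qed.

Lemma norm_cis x : `|cis x| = 1.
Proof. by rewrite normc_def /= cos2Dsin2 sqrtr1. Qed.

Lemma cis_neq1 x : 0 < x < 2 * pi -> cis x != 1.
Proof.
move=> /andP[x0 x2]; apply/eqP => -[]; rewrite (_ : x = (x / 2) *+ 2); last by field.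
rewrite cos_mulr2n cos2sin2 => e _.
have /eqP : sin (x / 2) ^+ 2 = 0 by lra.
rewrite sqrf_eq0 => /eqP s0.
have : 0 < sin (x / 2) by apply: sin_gt0_pi; lra.
by rewrite s0 ltxx.
Qed.

Lemma cis_primitive n : (0 < n)%N -> n.-primitive_root (cis (2 * pi / n%:R : R)).
Proof.
move=> n0; rewrite /primitive_root_of_unity n0 /=; apply/forallP => -[i lt_in].
rewrite unity_rootE /= -cisMn; apply/eqP.
have n0' : 0 < n%:R :> R by rewrite ltr0n.
have p0 := @pi_gt0 R.
case: (eqVneq i.+1 n) => [->|ne].
  by rewrite -[X in cis X]mulr_natr mulfVK ?cis_2pi ?eqxx // gt_eqF.
apply/negbTE/cis_neq1; rewrite -[_ *+ i.+1]mulr_natr mulrAC; apply/andP; split.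
  by rewrite divr_gt0// !mulr_gt0// ltr0n.
rewrite ltr_pdivrMr// ltr_pM2l ?mulr_gt0// ltr_nat.
by rewrite ltn_neqAle ne lt_in.
Qed.

Lemma one_plus_cis x : 1 + cis (x + x) = (2 * cos x)%:C%C * cis x.
Proof.
apply/eqP; rewrite /cis eq_complex /=; apply/andP; split; apply/eqP.
  have := cos2Dsin2 x => e; rewrite cosD -{1}e; ring.
by rewrite sinD; ring.
Qed.

Lemma one_minus_cis x :
  1 - cis (- (x + x)) = (2 * sin x)%:C%C * cis (pi / 2 - x).
Proof.
have -> : cis (pi / 2 - x) = (sin x +i* cos x)%C.
  by rewrite /cis -opprB cosN sinN cosBpihalf sinBpihalf opprK.
apply/eqP; rewrite /cis eq_complex /=; apply/andP; split; apply/eqP.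
  have := cos2Dsin2 x => e; rewrite cosN cosD -{1}e; ring.
by rewrite sinN sinD; ring.
Qed.
End Cis.

(** The argument of a nonzero complex number, as a relation: no determination of
    the argument is chosen, and positive factors such as the orders of kernels
    can be forgotten. *)
Definition has_phase (R : realType) (theta : R) (z : R[i]) : Prop :=
  exists2 r : R, 0 < r & z = r%:C%C * cis theta.

Lemma prod_double (A : comNzRingType) (F : nat -> A) a :
  \prod_(i < a.*2) F i = \prod_(l < a) (F l.*2 * F l.*2.+1).
Proof.
elim: a => [|a IH]; first by rewrite !big_ord0.
by rewrite doubleS !big_ord_recr /= IH mulrA.
Qed.

(** With b = pi / (4 a) and t = - cis (- 2 b), the sum is the product of the
    1 + t^j for 0 < j < 2 a.  The factors of indices 2 l and 2 l + 1 multiply to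
    4 cos (2 l b) sin ((2 l + 1) b) cis (pi / 2 - (4 l + 1) b); the real factors
    are positive because l < a, and the arguments add up to pi / 4. *)
Lemma gauss_sum_phase (R : realType) (a : nat) : (0 < a)%N ->
  has_phase (pi / 4 : R)
    (\sum_(j < a.*2) cis (2 * pi / (4 * a)%:R) ^+ (j ^ 2)).
Proof.
move=> a0; have a0' : 0 < a%:R :> R by rewrite ltr0n.
have p0 := @pi_gt0 R.
pose b : R := pi / (4 * a%:R).
have b0 : 0 < b by rewrite divr_gt0// mulr_gt0.
have ab : a%:R * b = pi / 4 by rewrite /b; field; rewrite lt0r_neq0.
have -> : 2 * pi / (4 * a)%:R = b + b.
  by rewrite /b natrM; field; rewrite lt0r_neq0.
have [N aN] : exists N, a.*2 = N.+1 by exists a.*2.-1; rewrite prednK// double_gt0.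
pose t := (-1 : R[i]) * cis (- (b + b)).
have tn l : t ^+ l = (-1) ^+ l * cis (- (b *+ l + b *+ l)).
  by rewrite /t exprMn -cisMn mulNrn mulrnDl.
have tN : N.+1.-primitive_root (t ^+ 2).
  rewrite -aN tn sqrrN expr1n mul1r.
  have -> : - (b *+ 2 + b *+ 2) = (2 * pi / a.*2%:R) *+ a.*2.-1 - 2 * pi.
    rewrite -[_ *+ a.*2.-1]mulr_natr -subn1 natrB ?double_gt0// -muln2 natrM /b.
    by field; rewrite lt0r_neq0.
  have -> : forall x : R, cis (x - 2 * pi) = cis x.
    by move=> x; rewrite -{2}(subrK (2 * pi) x) [RHS]cisD cis_2pi mulr1.
  rewrite cisMn prim_root_exp_coprime ?cis_primitive ?double_gt0//.
  by rewrite aN coprimenS.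
rewrite aN (@gauss_product _ t _ _ _ tN); last first.
  by rewrite /t -mulrA [_ * cis (b + b)]mulrC cisMcisN mulr1.
pose F l := 1 + t ^+ l.
have {tN} : 2 * \prod_(i < N) F i.+1 = \prod_(i < a.*2) F i.
  by rewrite aN big_ord_recl /= /F expr0.
(* The index 0 only contributes 1 + t^0 = 2; with it, the factors pair up. *)
rewrite prod_double => e.
have pair l : (l < a)%N -> F l.*2 * F l.*2.+1 =
    (4 * cos (b *+ l.*2) * sin (b *+ l.*2.+1))%:C%C * cis (pi / 2 - b *+ (4 * l + 1)).
  move=> la; rewrite /F !tn exprS -muln2 exprM exprAC sqrrN !expr1n mulr1 mul1r.
  rewrite opprD one_plus_cis mulN1r one_minus_cis cosN mulrACA -cisD -rmorphM /=.
  congr (_%:C%C * cis _); first by ring.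
  by rewrite -![b *+ _]mulr_natr; rewrite !natrD !natrM; ring.
have part k : (k <= a)%N -> exists2 r : R, 0 < r &
    \prod_(l < k) (F l.*2 * F l.*2.+1) =
      r%:C%C * cis (pi / 2 * k%:R - b * (k%:R * (2 * k%:R - 1))).
  elim: k => [_|k IH ka].
    by exists 1 => //; rewrite big_ord0 mulr0 mul0r mulr0 subrr cis0 mulr1.
  have [r r0 rE] := IH (ltnW ka).
  exists (r * (4 * cos (b *+ k.*2) * sin (b *+ k.*2.+1))).
    have ka' : k%:R + 1 <= a%:R :> R by rewrite natr1 ler_nat.
    have k0 : 0 <= k%:R :> R by rewrite ler0n.
    have kb : (k%:R + 1) * b <= pi / 4 by rewrite -ab ler_wpM2r// ltW.
    have kb0 : 0 <= k%:R * b by rewrite mulr_ge0// ltW.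
    rewrite !mulr_gt0//.
      apply: cos_gt0_pihalf; rewrite -[b *+ _]mulr_natr -mul2n natrM.
      by apply/andP; split; nra.
    apply: sin_gt0_pi; rewrite -[b *+ _]mulr_natr -addn1 -mul2n natrD natrM.
    by apply/andP; split; nra.
  rewrite big_ord_recr /= rE pair// mulrACA -cisD -rmorphM /=; congr (_ * cis _).
  by rewrite -[b *+ (4 * k + 1)]mulr_natr natrD natrM -natr1; ring.
have [r r0 rE] := part a (leqnn a).
exists (r / 2); first by rewrite divr_gt0.
apply: (@mulfI _ (2 : R[i])); first by rewrite pnatr_eq0.
rewrite e rE [RHS]mulrA; congr (_ * cis _).
  rewrite -[2 in RHS]/((2 : nat)%:R) -(rmorph_nat (@real_complex_def _ (Phant R))).
  by rewrite -rmorphM /= mulrC divfK// pnatr_eq0.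
by rewrite mulrCA mulrA ab; field.
Qed.

(** * Sums over finite abelian groups *)

(** Translation by s permutes K and multiplies the sum by [beta s]. *)
Lemma character_sum (F : idomainType) (G : finZmodType) (K : {set G})
    (beta : G -> F) :
  {in K &, forall s t, s - t \in K} ->
  {in K &, forall s t, beta (s + t) = beta s * beta t} ->
  \sum_(t in K) beta t = if [forall t in K, beta t == 1] then #|K|%:R else 0.
Proof.
move=> KB betaD.
have KN t : t \in K -> - t \in K.
  by move=> tK; rewrite -sub0r KB// -(subrr t) KB.
have KD s t : s \in K -> t \in K -> s + t \in K.
  by move=> sK tK; rewrite -[t]opprK KB// KN.
case: ifP => [/forall_inP b1|/negbT]; first by
  rewrite (eq_bigr (fun=> 1)) ?sumr_const// => t /b1 /eqP.
rewrite negb_forall => /existsP[s]; rewrite negb_imply => /andP[sK bs].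
apply: (mulfI (x := 1 - beta s)); first by rewrite subr_eq0 eq_sym.
rewrite mulr0 mulrBl mul1r; apply/eqP; rewrite subr_eq0; apply/eqP.
rewrite mulr_sumr (reindex_inj (addrI s)) /=; apply: eq_big => [t|t tK].
  apply/idP/idP => [stK|/(KD _ _ sK)//].
  by rewrite -[t](addKr s) KD// KN.
by rewrite betaD// -(addKr s t) KD// KN.
Qed.

(** The hypotheses say that translating by t in K multiplies [chi x] by
    [beta x t], a character of K in the variable t.  Averaging over the
    translations keeps the x for which this character is trivial: the orthogonal
    of K. *)
Lemma isotropic_sum (F : numFieldType) (G : finZmodType) (K : {set G})
    (chi : G -> F) (beta : G -> G -> F) :
  0 \in K -> {in K &, forall s t, s - t \in K} ->
  (forall x, {in K, forall t, chi (x + t) = chi x * beta x t}) ->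
  (forall x, {in K &, forall s t, beta x (s + t) = beta x s * beta x t}) ->
  \sum_x chi x = \sum_(x | [forall t in K, beta x t == 1]) chi x.
Proof.
move=> K0 KB chiD betaD.
have K_neq0 : #|K|%:R != 0 :> F.
  by rewrite pnatr_eq0 -lt0n; apply/card_gt0P; exists 0.
apply: (mulfI K_neq0); rewrite mulr_natl -sumr_const.
transitivity (\sum_(t in K) \sum_x chi (x + t)).
  by apply: eq_bigr => t _; rewrite [LHS](reindex_inj (addIr t)).
rewrite exchange_big /= mulr_sumr [RHS]big_mkcond /=; apply: eq_bigr => x _.
rewrite (eq_bigr _ (fun t tK => chiD x t tK)) -mulr_sumr.
rewrite (character_sum KB (betaD x)).
by case: ifP => _; rewrite ?mulr0// mulrC.
Qed.

Lemma fiber_sum (F : nzRingType) (G H : finZmodType) (J : {set G})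
    (p : {additive G -> H}) (f : H -> F) :
  0 \in J -> {in J &, forall s t, s - t \in J} ->
  \sum_(y in J) f (p y) =
    #|[set y in J | p y == 0]|%:R * \sum_(x in p @: J) f x.
Proof.
move=> J0 JB.
have JD s t : s \in J -> t \in J -> s + t \in J.
  by move=> sK tK; rewrite -[t]opprK JB// -sub0r JB.
rewrite (partition_big p [in p @: J]) /=; last by move=> y yJ; apply: imset_f.
rewrite mulr_sumr; apply: eq_bigr => _ /imsetP[y0 y0J ->].
rewrite (eq_bigr (fun=> f (p y0))) => [|y /andP[_ /eqP->]//].
rewrite sumr_const mulr_natl; congr (_ *+ _).
rewrite -(card_imset [set y in J | p y == 0] (addrI y0)); apply: eq_card => y.
rewrite [LHS]inE; apply/idP/imsetP => [/andP[yJ /eqP pE]|[z]].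
  by exists (y - y0); rewrite ?inE ?JB ?raddfB ?pE ?subrr ?eqxx// addrC subrK.
by rewrite inE => /andP[zJ /eqP z0] ->; rewrite JD// raddfD z0 addr0 eqxx.
Qed.

Lemma fiber_card_gt0 (G H : finZmodType) (J : {set G}) (p : {additive G -> H}) :
  0 \in J -> (0 < #|[set y in J | p y == 0%R]|)%N.
Proof. by move=> J0; apply/card_gt0P; exists 0; rewrite inE J0 raddf0 eqxx. Qed.

Section Phase.
Variable R : realType.
Implicit Types (x y z : R[i]) (s t : R).

Lemma has_phaseM s t x y :
  has_phase s x -> has_phase t y -> has_phase (s + t) (x * y).
Proof.
move=> [r r0 ->] [r' r'0 ->]; exists (r * r'); first exact: mulr_gt0.
by rewrite mulrACA -rmorphM -cisD.
Qed.

Lemma has_phase_nat n : (0 < n)%N -> has_phase (0 : R) n%:R.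
Proof.
move=> n0; exists n%:R; first by rewrite ltr0n.
by rewrite cis0 mulr1 rmorph_nat.
Qed.

Lemma has_phase_prod (I : finType) (t : I -> R) (x : I -> R[i]) :
  (forall i, has_phase (t i) (x i)) -> has_phase (\sum_i t i) (\prod_i x i).
Proof.
move=> h; elim/big_rec2: _ => [|i s y _ IH].
  by exists 1; rewrite ?cis0 ?mulr1.
exact: has_phaseM.
Qed.

Lemma has_phase_conj t x : has_phase t x -> has_phase (- t) (x^*)%C.
Proof. by move=> [r r0 ->]; exists r => //; rewrite rmorphM cisN /= oppr0. Qed.

Lemma has_phase_cancel n t x : (0 < n)%N -> has_phase t (n%:R * x) ->
  has_phase t x.
Proof.
move=> n0 [r r0 e]; exists (r / n%:R); first by rewrite divr_gt0 ?ltr0n.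
have n0' : (n%:R : R[i]) != 0 by rewrite pnatr_eq0 -lt0n.
apply: (mulfI n0'); rewrite e rmorphM fmorphV /= rmorph_nat.
by rewrite mulrA [_ * (_ / _)]mulrCA divff// mulr1.
Qed.
End Phase.

(** J is a correspondence from [W] to [V].  Both sums are equal to the sum over J,
    up to the orders of the kernels of p and q on J. *)
Lemma correspondence_phase (R : realType) (t : R) (G W V : finZmodType)
    (J : {set G}) (p : {additive G -> W}) (q : {additive G -> V})
    (f : W -> R[i]) (g : V -> R[i]) :
  0 \in J -> {in J &, forall x y, x - y \in J} ->
  {in J, forall y, f (p y) = g (q y)} ->
  has_phase t (\sum_(v in q @: J) g v) -> has_phase t (\sum_(w in p @: J) f w).
Proof.
move=> J0 JB fg h; apply: (has_phase_cancel (fiber_card_gt0 p J0)).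
rewrite -fiber_sum// (eq_bigr _ fg) fiber_sum// -[t]add0r.
exact/has_phaseM/h/has_phase_nat/fiber_card_gt0.
Qed.

(** * The Gauss sum of a unimodular symmetric matrix *)

Lemma exprz_prim (F : fieldType) (n : nat) (z : F) (k : int) :
  n.-primitive_root z -> (z ^ k == 1) = (n %| k)%Z.
Proof.
move=> zn; rewrite dvdzE; case: k => k /=; first by rewrite (prim_order_dvd zn).
by rewrite invr_eq1 (prim_order_dvd zn).
Qed.

Lemma sum_periodic (V : nmodType) (f : nat -> V) (p c : nat) :
  (forall x, f (p + x)%N = f x) ->
  \sum_(x < p * c) f x = (\sum_(x < p) f x) *+ c.
Proof.
move=> fp; elim: c => [|c IH]; first by rewrite muln0 big_ord0.
rewrite mulnS big_split_ord /= mulrS; congr (_ + _).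
by rewrite -IH; apply: eq_bigr => i _; rewrite fp.
Qed.

Section OneDim.
Variable R : realType.

(** The summand has period 2 a, so this is c times the sum of
    [gauss_sum_phase]. *)
Lemma gauss_sum_multiple (a c : nat) : (0 < a)%N -> (0 < c)%N ->
  has_phase (pi / 4 : R)
    (\sum_(x < 2 * (a * c)) cis (2 * pi / (4 * (a * c))%:R) ^+ (x ^ 2 * c)).
Proof.
move=> a0 c0; set w := cis (2 * pi / (4 * a)%:R : R).
have wE : cis (2 * pi / (4 * (a * c))%:R : R) ^+ c = w.
  rewrite -cisMn -[_ *+ c]mulr_natr; congr cis; rewrite !natrM.
  by field; rewrite !pnatr_eq0 -!lt0n a0 c0.
under eq_bigr => x _ do rewrite (mulnC (x ^ 2)%N) exprM wE.
have w1 : w ^+ (4 * a) = 1.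
  by apply: prim_expr_order; apply: cis_primitive; rewrite muln_gt0.
rewrite mulnA (@sum_periodic _ (fun x => w ^+ (x ^ 2))) => [|x]; last first.
  have -> : ((2 * a + x) ^ 2 = 4 * a * (a + x) + x ^ 2)%N.
    by rewrite -!mulnn; lia.
  by rewrite exprD exprM w1 expr1n mul1r.
rewrite -[_ *+ c]mulr_natl -[pi / 4]add0r mul2n.
by apply: has_phaseM; [exact: has_phase_nat|exact: gauss_sum_phase].
Qed.

(** The sum of exp(pi i x^2 / (2 d)), taken over a multiple of its period.  With
    e = N / d it is written as a sum of powers of exp(2 pi i / (4 N)), the same
    root of unity for all the divisors d of N; it is conjugated when d changes
    sign. *)
Lemma gauss_sum_Zp (N : nat) (d e : int) : (0 < N)%N -> d * e = N%:Z ->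
  has_phase (pi / 4 * (sgz d)%:~R : R)
    (\sum_(x : 'Z_(2 * N)) cis (2 * pi / (4 * N)%:R) ^ ((x : nat)%:Z ^+ 2 * e)).
Proof.
move=> N0 de; set w := cis _.
have d0 : d != 0 by apply/eqP => d0; move: de; rewrite d0; lia.
have e0 : e != 0 by apply/eqP => e0; move: de; rewrite e0; lia.
have NE : (`|d| * `|e|)%N = N by rewrite -abszM de.
have M1 : (1 < 2 * N)%N by lia.
have sumE (F : nat -> R[i]) : \sum_(x : 'Z_(2 * N)) F x = \sum_(x < 2 * N) F x.
  by rewrite -!(big_mkord xpredT F) Zp_cast.
rewrite (sumE (fun x => w ^ (x%:Z ^+ 2 * e))).
have := @gauss_sum_multiple `|d| `|e|; rewrite !absz_gt0 d0 e0 NE => /(_ isT isT) h.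
have [dp|dn|/eqP] := ltgtP 0 d; last by rewrite eq_sym (negbTE d0).
  rewrite gtr0_sgz// mulr1; have ep : 0 < e by nia.
  rewrite (eq_bigr (fun x : 'I__ => w ^+ (x ^ 2 * `|e|)))// => x _.
  have -> // : x%:Z ^+ 2 * e = (x ^ 2 * `|e|)%N%:Z.
  by rewrite PoszM gtz0_abs// expr2 -mulnn.
rewrite ltr0_sgz// mulrN1; have en : e < 0 by nia.
rewrite (eq_bigr (fun x : 'I__ => ((w ^+ (x ^ 2 * `|e|))^*)%C)) => [|x _].
  by rewrite -rmorph_sum; exact: has_phase_conj.
have -> : e = - (`|e|%N : int) by rewrite ltz0_abs// opprK.
rewrite abszN absz_nat mulrN -invr_expz.
have -> : x%:Z ^+ 2 * `|e|%N%:Z = (x ^ 2 * `|e|)%N%:Z by rewrite PoszM expr2 -mulnn.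
by rewrite -exprnP -cisMn -cisN cisV.
Qed.
End OneDim.

Definition bform (A : comNzRingType) (n : nat) (S : 'M[A]_n) (x y : 'rV[A]_n) : A :=
  (x *m S *m y^T) 0 0.

Section Bform.
Variables (A : comNzRingType) (n : nat) (S : 'M[A]_n).
Implicit Types (x y z : 'rV[A]_n) (k : A).

Lemma bformDl x y z : bform S (x + y) z = bform S x z + bform S y z.
Proof. by rewrite /bform !mulmxDl mxE. Qed.

Lemma bformDr x y z : bform S x (y + z) = bform S x y + bform S x z.
Proof. by rewrite /bform linearD /= mulmxDr mxE. Qed.

Lemma bformZl k x y : bform S (k *: x) y = k * bform S x y.
Proof. by rewrite /bform -!scalemxAl mxE. Qed.

Lemma bformZr k x y : bform S x (k *: y) = k * bform S x y.
Proof. by rewrite /bform linearZ /= -scalemxAr mxE. Qed.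

Lemma bformMl T x y : bform S (x *m T) y = bform (T *m S) x y.
Proof. by rewrite /bform !mulmxA. Qed.

Lemma bformMr T x y : bform S x (y *m T) = bform (S *m T^T) x y.
Proof. by rewrite /bform trmx_mul !mulmxA. Qed.

Lemma bform_sym x y : S^T = S -> bform S y x = bform S x y.
Proof.
move=> ST; rewrite /bform -[in RHS](trmxK (x *m S *m y^T)) [RHS]mxE.
by rewrite !trmx_mul trmxK ST mulmxA.
Qed.

Lemma qformD x y : S^T = S ->
  bform S (x + y) (x + y) = bform S x x + bform S y y + 2 * bform S x y.
Proof. by move=> ST; rewrite bformDl !bformDr (bform_sym x y ST); ring. Qed.
End Bform.

Lemma bformZ (A : comNzRingType) (n : nat) (S : 'M[A]_n) k x y :
  bform (k *: S) x y = k * bform S x y.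
Proof. by rewrite /bform -scalemxAr -scalemxAl mxE. Qed.

Section IntMod.
Variables (M n : nat).
Hypothesis M_gt1 : (1 < M)%N.

Definition mod_mx : 'rV[int]_n -> 'rV['Z_M]_n := map_mx intr.
HB.instance Definition _ := GRing.Additive.on mod_mx.

Definition lift_mx (x : 'rV['Z_M]_n) : 'rV[int]_n :=
  map_mx (fun y : 'Z_M => (y : nat)%:Z) x.

Lemma lift_mxK : cancel lift_mx mod_mx.
Proof. by move=> x; apply/rowP => j; rewrite !mxE -pmulrn natr_Zp. Qed.

Lemma intr_Zp_eq0 (k : int) : ((k%:~R : 'Z_M) == 0) = (M %| k)%Z.
Proof.
rewrite dvdzE; have h m : ((m%:R : 'Z_M) == 0) = (M %| m)%N.
  by rewrite -val_eqE /= val_Zp_nat.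
by case: k => m; rewrite ?NegzE ?mulrNz ?oppr_eq0 -pmulrn h ?abszN.
Qed.

Lemma mod_mx_eq (x y : 'rV[int]_n) :
  mod_mx x = mod_mx y -> exists z, x = y + M%:Z *: z.
Proof.
move=> e; exists (\row_(j < n) ((x - y) ord0 j %/ M)%Z); apply/rowP => j.
have /eqP : mod_mx (x - y) 0 j = 0 by rewrite (raddfB mod_mx) /= e subrr mxE.
rewrite mxE intr_Zp_eq0 => /divzK; rewrite !mxE => e'.
by rewrite mulrC e' addrC subrK.
Qed.
End IntMod.

Lemma sum_row_prod (F : comNzRingType) (T : finType) (n : nat)
    (g : 'I_n -> T -> F) :
  \sum_(x : 'rV[T]_n) \prod_j g j (x 0 j) = \prod_j \sum_y g j y.
Proof.
rewrite bigA_distr_bigA /= (reindex (fun f : {ffun 'I_n -> T} => \row_j f j)).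
  by apply: eq_bigr => f _; apply: eq_bigr => j _; rewrite mxE.
exists (fun x : 'rV_n => [ffun j => x 0 j]) => [f _|x _].
  by apply/ffunP => j; rewrite ffunE mxE.
by apply/rowP => j; rewrite mxE ffunE.
Qed.

Lemma scalemxI (A : idomainType) (m n : nat) (k : A) :
  k != 0 -> injective (fun S : 'M[A]_(m, n) => k *: S).
Proof.
move=> k0 S T /matrixP e; apply/matrixP => i j.
by have := e i j; rewrite !mxE => /(mulfI k0).
Qed.

(** Milgram's argument.  Let N be the product of the |d_j|, let E be the diagonal
    matrix of the N / d_j and let omega = exp(2 pi i / (4 N)).  On G = (Z / 2N)^n put
    chi(x) = omega^(x E x^T), the product of the exp(pi i x_j^2 / (2 d_j)).
    This comes from the discriminant form of diag(2 d_j), which is the form 2 B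
    on the sublattice P Z^n.  Its sum over G is a product of one-dimensional
    Gauss sums.

    The overlattice Z^n sits in G as K, the image of y |-> 2 y P.  As
    P E P^T = N A with A the inverse of B, chi is trivial on K, and x is
    orthogonal to K exactly when N divides x E P^T, that is, x = w B P for an
    integral w; there chi(w B P) = omega^(N w B w^T) = i^(w B w^T).  So
    [isotropic_sum] replaces the sum over G by the sum over the w B P.

    The conclusion speaks of some G and p, and not of the sum over (Z / 2)^n, because
    the former is what [correspondence_phase] uses. *)
Lemma unimodular_gauss_sum (R : realType) (n : nat) (B A P : 'M[int]_n)
    (d : 'rV[int]_n) :
  B^T = B -> B *m A = 1%:M -> P^T *m B *m P = diag_mx d ->
  (forall j, d 0 j != 0) ->
  exists (G : finZmodType) (p : {additive 'rV[int]_n -> G}) (chi : G -> R[i]),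
    (forall w, chi (p w) = 'i%C ^ bform B w w) /\
    has_phase (pi / 4 * (\sum_j sgz (d 0 j))%:~R)
      (\sum_(x | `[< exists w, x = p w >]) chi x).
Proof.
move=> BT BA PBP d0.
have AB : A *m B = 1%:M by apply: mulmx1C.
pose N := (\prod_j `|d 0%R j|)%N.
have N0 : (0 < N)%N by apply: prodn_gt0 => j; rewrite absz_gt0.
pose e : 'rV[int]_n := \row_(j < n) (N%:Z %/ d ord0 j)%Z.
have de j : d 0 j * e 0 j = N%:Z.
  rewrite mxE mulrC divzK// dvdzE /= /N (bigD1 j)//=; exact: dvdn_mulr.
pose E := diag_mx e.
have ET : E^T = E by rewrite /E tr_diag_mx.
have DE : diag_mx d *m E = N%:Z%:M.
  rewrite /E mulmx_diag -diag_const_mx; congr diag_mx.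
  by apply/rowP => j; rewrite [LHS]mxE de mxE.
have ED : E *m diag_mx d = N%:Z%:M by rewrite diag_mxC.
(* E P^T B / N is a left inverse of P, hence also a right inverse. *)
have PEP : P *m E *m P^T = N%:Z *: A.
  have XP : E *m P^T *m B *m P = N%:Z%:M by rewrite -ED -PBP !mulmxA.
  have detP : \det P != 0.
    apply/eqP => P0; have /(congr1 determinant) := XP.
    rewrite det_mulmx P0 mulr0 det_scalar => /esym/eqP.
    by rewrite expf_eq0 => /andP[_]; rewrite eqz_nat; case: (N) N0.
  have : (P *m (E *m P^T *m B) - N%:Z%:M) *m P = 0.
    by rewrite mulmxBl -[P *m _ *m P]mulmxA XP scalar_mxC subrr.
  move/(congr1 (mulmx^~ (\adj P))); rewrite /= mul0mx -[_ *m P *m _]mulmxA mul_mx_adj.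
  rewrite mul_mx_scalar -[RHS](scaler0 _ (\det P)) => /(scalemxI detP)/eqP.
  rewrite subr_eq0 => /eqP /(congr1 (mulmx^~ A)).
  by rewrite -!mulmxA BA mulmx1 mul_scalar_mx !mulmxA.
pose M := (2 * N)%N; have M1 : (1 < M)%N by rewrite /M; lia.
pose omega := cis (2 * pi / (4 * N)%:R : R).
have omega_prim : (4 * N)%N.-primitive_root omega.
  by apply: cis_primitive; rewrite muln_gt0.
have omega0 : omega != 0 by apply: cis_neq0.
have omega1 (k : int) : omega ^ ((4 * N)%N%:Z * k) = 1.
  by apply/eqP; rewrite (exprz_prim _ omega_prim) dvdz_mulr.
pose red := @mod_mx M n; pose lift := @lift_mx M n.
pose chi (x : 'rV['Z_M]_n) := omega ^ bform E (lift x) (lift x).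
pose beta (x y : 'rV['Z_M]_n) := omega ^ (2 * bform E (lift x) (lift y)).
have redK x : exists z, lift (red x) = x + M%:Z *: z.
  by apply: mod_mx_eq => //; exact: lift_mxK.
have chi_red x : chi (red x) = omega ^ bform E x x.
  rewrite /chi; have [z ->] := redK x; rewrite qformD// !bformZl !bformZr.
  rewrite -addrA exprzDr// [X in _ * X](_ : _ = 1) ?mulr1//.
  rewrite -[RHS](omega1 (N%:Z * bform E z z + bform E x z)); congr (_ ^ _).
  by rewrite /M !PoszM; ring.
have beta_red x y : beta (red x) (red y) = omega ^ (2 * bform E x y).
  rewrite /beta; have [z ->] := redK x; have [t ->] := redK y.
  rewrite bformDl !bformDr !bformZl !bformZr.
  rewrite -!addrA mulrDr exprzDr// [X in _ * X](_ : _ = 1) ?mulr1//.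
  rewrite -[RHS](omega1 (bform E x t + bform E z y + M%:Z * bform E z t)).
  by congr (_ ^ _); rewrite /M !PoszM; ring.
have redP x : exists z, x = red z by exists (lift x); rewrite /red lift_mxK.
pose K := [set x | `[< exists y, x = red (2 *: (y *m P)) >]].
have sum_chi : has_phase (pi / 4 * (\sum_j sgz (d 0 j))%:~R) (\sum_x chi x).
  have chiE x : chi x = \prod_j omega ^ ((x 0 j : nat)%:Z ^+ 2 * e 0 j).
    rewrite /chi.
    have -> : bform E (lift x) (lift x) = \sum_j (x 0 j : nat)%:Z ^+ 2 * e 0 j.
      rewrite /bform mul_mx_diag mxE; apply: eq_bigr => j _.
      by rewrite !mxE expr2 mulrAC.
    elim/big_rec2: _ => [|j y1 y2 _ <-]; first exact: expr0z.
    by rewrite exprzDr.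
  rewrite (eq_bigr _ (fun x _ => chiE x)).
  rewrite (sum_row_prod (fun j (y : 'Z_M) => omega ^ ((y : nat)%:Z ^+ 2 * e 0 j))).
  rewrite raddf_sum mulr_sumr; apply: has_phase_prod => j.
  exact: gauss_sum_Zp (de j).
exists 'rV['Z_M]_n, (red \o mulmxr (B *m P)), chi; split=> [w|].
  rewrite /= chi_red bformMl bformMr trmx_mul BT.
  have -> : B *m P *m E *m (P^T *m B) = N%:Z *: B.
    by rewrite !mulmxA -[B *m P *m E]mulmxA -[B *m _ *m P^T]mulmxA PEP
       -scalemxAr -scalemxAl BA mul1mx.
  rewrite bformZ -exprz_exp; congr (_ ^ _).
  rewrite -exprnP -cisMn -cis_pihalf; congr cis.
  rewrite -[_ *+ N]mulr_natr natrM; field.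
  by rewrite pnatr_eq0 -lt0n.
move: sum_chi; rewrite (@isotropic_sum _ _ K _ beta).
- rewrite (eq_bigl (fun x => `[< exists w, x = red (w *m (B *m P)) >]))// => x.
  apply/forall_inP/asboolP => [h|[w ->] t].
    have [z zE] := redP x; rewrite zE in h *; pose v := z *m E *m P^T.
    have vN j : (N %| v ord0 j)%Z.
      have /h : red (2 *: (delta_mx 0 j *m P)) \in K.
        by rewrite inE; apply/asboolP; exists (delta_mx 0 j).
      rewrite beta_red (exprz_prim _ omega_prim) bformZr bformMr mulrA.
      rewrite PoszM (@dvdz_mul2l 4)// /bform mulmxA -/v trmx_delta.
      by rewrite -colE mxE.
    pose w := \row_(j < n) (v ord0 j %/ N)%Z.
    have vE : v = N%:Z *: w by apply/rowP => j; rewrite [RHS]mxE [w _ _]mxE mulrC divzK.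
    exists w; congr red; apply: (@scalemxI _ _ _ N%:Z); first by rewrite eqz_nat -lt0n.
    rewrite /= scalemxAl -vE /v -!mulmxA [_ *m (B *m P)]mulmxA PBP ED.
    by rewrite mul_mx_scalar.
  rewrite inE => /asboolP[y ->]; rewrite beta_red bformZr mulrA.
  rewrite bformMl bformMr -!mulmxA [P *m _]mulmxA PEP -scalemxAr BA bformZ mulrA.
  by rewrite -[X in _ ^ (X * _)]/((4 * N%:Z)) -PoszM omega1.
- by rewrite inE; apply/asboolP; exists 0; rewrite mul0mx scaler0 /red raddf0.
- move=> s t; rewrite ![_ \in K]finset.in_set.
  move=> /asboolP[x ->] /asboolP[y ->]; apply/asboolP.
  by exists (x - y); rewrite mulmxBl scalerBr /red raddfB.
- move=> x t tK; have [z ->] := redP x; move: tK; rewrite inE => /asboolP[y ->].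
  rewrite -[red z + _](raddfD (@mod_mx M n)) /= -/red !chi_red beta_red qformD//.
  rewrite !exprzDr// -mulrA mulrCA -[RHS]mul1r; congr (_ * _).
  rewrite bformZl bformZr bformMl bformMr PEP bformZ -[RHS](omega1 (bform A y y)).
  by congr (_ ^ _); rewrite PoszM; ring.
- move=> x s t _ _; have [z ->] := redP x; have [y ->] := redP s.
  have [u ->] := redP t; rewrite -[red y + _](raddfD (@mod_mx M n)) /= -/red.
  by rewrite !beta_red bformDr mulrDr exprzDr.
Qed.

Lemma clear_denominators (n : nat) (P : 'M[rat]_n) :
  exists2 t : int, t != 0 & exists P0 : 'M[int]_n, map_mx intr P0 = t%:~R *: P.
Proof.
pose t := \prod_(ij : 'I_n * 'I_n) denq (P ij.1 ij.2).
exists t; first by apply/prodf_neq0 => ij _; exact: denq_neq0.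
exists (\matrix_(i, j) (numq (P i j) *
  \prod_(kl : 'I_n * 'I_n | kl != (i, j)) denq (P kl.1 kl.2))).
apply/matrixP => i j; rewrite !mxE; have -> : t = denq (P i j) *
    \prod_(kl : 'I_n * 'I_n | kl != (i, j)) denq (P kl.1 kl.2).
  by rewrite /t (bigD1 (i, j)).
rewrite !intrM.
rewrite -[X in _ = _ * X](divq_num_den (P i j)) mulrAC mulrCA divff ?mulr1 1?mulrC//.
by rewrite intr_eq0 denq_neq0.
Qed.

Lemma unimodular_gauss_sum_rat (R : realType) (n : nat) (B A : 'M[int]_n)
    (P : 'M[rat]_n) (sigma : int) :
  B^T = B -> B *m A = 1%:M -> P \in unitmx ->
  is_diag_mx (P^T *m map_mx intr B *m P) ->
  sigma = \sum_i sgz ((P^T *m map_mx intr B *m P) i i) ->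
  exists (G : finZmodType) (p : {additive 'rV[int]_n -> G}) (chi : G -> R[i]),
    (forall w, chi (p w) = 'i%C ^ bform B w w) /\
    has_phase (pi / 4 * sigma%:~R)
      (\sum_(x | `[< exists w, x = p w >]) chi x).
Proof.
move=> BT BA Punit Ddiag sigmaE.
have [t t0 [P0 P0E]] := clear_denominators P.
set D := P^T *m _ *m P in Ddiag sigmaE.
pose D0 := P0^T *m B *m P0.
have D0E : map_mx intr D0 = (t%:~R ^+ 2) *: D.
  rewrite !map_mxM -map_trmx P0E [(_ *: P)^T]linearZ /=.
  by rewrite -!scalemxAl -scalemxAr scalerA -expr2.
have t0' : (t%:~R : rat) != 0 by rewrite intr_eq0.
pose d : 'rV_n := \row_i D0 i i.
have dE : D0 = diag_mx d.
  apply/matrixP => i j; rewrite [RHS]mxE; case: eqVneq => [->|ij].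
    by rewrite mulr1n [RHS]mxE.
  rewrite mulr0n; apply/eqP; rewrite -(intr_eq0 rat).
  have := congr1 (fun S : 'M[rat]_n => S i j) D0E.
  rewrite [LHS]mxE [RHS]mxE => ->.
  by move/is_diag_mxP: Ddiag => /(_ i j ij) ->; rewrite mulr0.
have sgzE i : sgz (d 0 i) = sgz (D i i).
  have := congr1 (fun S : 'M[rat]_n => S i i) D0E.
  rewrite [LHS]mxE [RHS]mxE [d _ _]mxE => e.
  rewrite -(sgz_int rat) e sgzM sgzX expr2 -sgzM -expr2.
  by rewrite gtr0_sgz ?mul1r// exprn_even_gt0.
rewrite sigmaE -(eq_bigr _ (fun i _ => sgzE i)).
apply: (unimodular_gauss_sum R BT BA dE) => j.
have : \det D0 != 0.
  rewrite -(intr_eq0 rat) -det_map_mx D0E detZ mulf_neq0 ?expf_neq0//.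
  have detP : \det P != 0 by rewrite -unitfE -unitmxE.
  rewrite !det_mulmx det_tr !mulf_neq0// det_map_mx intr_eq0.
  apply/eqP => B0; move/(congr1 determinant): BA; rewrite det_mulmx B0 mul0r det1.
  by move/eqP; rewrite eq_sym oner_eq0.
by rewrite dE det_diag => /prodf_neq0/(_ j isT).
Qed.

(** Since adj(B) B = det(B), the hypothesis for N = det(B) shows that det(B)
    divides the adjugate.  And det(B) is not 0, as an entry of a vector killed by B
    would be divisible by twice itself. *)
Lemma unimodularP (n : nat) (B : 'M[int]_n) :
  (forall (N : int) (x : 'rV_n), N != 0 ->
    (forall j, (N %| (x *m B) ord0 j)%Z) -> forall j, (N %| x ord0 j)%Z) ->
  exists A, B *m A = 1%:M.
Proof.
move=> h; have detB : \det B != 0.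
  apply/det0P => -[v v0 vB]; case/negP: v0; apply/eqP/rowP => j.
  rewrite mxE; apply/eqP/negPn/negP => vj0.
  have : (2 * v ord0 j %| v ord0 j)%Z.
    by apply: h => [|i]; rewrite ?mulf_neq0// vB mxE dvdz0.
  rewrite dvdzE abszM => /dvdn_leq; rewrite absz_gt0 => /(_ vj0).
  by have : (0 < `|v ord0 j|)%N; [rewrite absz_gt0|lia].
pose A : 'M_n := \matrix_(i, j) (\adj B i j %/ \det B)%Z.
have AE : \adj B = \det B *: A.
  apply/matrixP => i j; rewrite [RHS]mxE [A _ _]mxE mulrC divzK//.
  suff : (\det B %| row i (\adj B) ord0 j)%Z by rewrite mxE.
  apply: h => // k; rewrite -row_mul mul_adj_mx !mxE.
  by case: eqP; rewrite ?dvdz0 ?dvdzz.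
exists A; apply: (scalemxI detB); rewrite /= scalemxAr -AE mul_mx_adj.
by rewrite scalemx1.
Qed.

(** * Smith normal form, bases and diagonalization *)

Lemma additive_mulmx (m n : nat) (f : {additive 'rV[int]_m -> 'rV[int]_n}) :
  exists M : 'M[int]_(m, n), forall x, f x = x *m M.
Proof.
exists (\matrix_i f (delta_mx 0 i)) => x.
rewrite {1}(row_sum_delta x) raddf_sum mulmx_sum_row; apply: eq_bigr => i _.
by rewrite rowK -[x 0 i]intz !scaler_int raddfMz.
Qed.

(** Smith normal form for a map of projective modules: in the coordinates
    [omega i] and the generators [beta i], the map d is diagonal, with entries
    [delta i].  The [beta i] need not be a basis, but questions about the image
    of d can still be settled one coordinate at a time, and the [omega i] generate
    the dual module. *)
Lemma smith_coordinates (A B : zmodType) (d : {additive A -> B}) :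
  fg_projective A -> fg_projective B ->
  exists (n : nat) (beta : 'I_n -> B) (omega : 'I_n -> {additive B -> int^o})
    (delta : 'I_n -> int),
  [/\ forall c, c = \sum_i beta i *~ omega i c,
      forall i a, (delta i %| omega i (d a))%Z
    & forall i, exists a, d a = beta i *~ delta i].
Proof.
move=> [m [iA [pA AK]]] [n [iB [pB BK]]].
have [M ME] := additive_mulmx (iB \o d \o pA).
have [L Lu [U Uu [s _ ME']]] := int_Smith_normal_form M.
(* Beyond the m-th row the diagonal is empty, whatever the sequence s contains. *)
pose delta (i : 'I_n) : int := if (i < m)%N then s`_i else 0.
have omegaP i : nmod_morphism (fun c => (iB c *m invmx U) 0 i : int^o).
  by split=> [|x y]; [rewrite raddf0 mul0mx mxE|rewrite raddfD mulmxDl mxE].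
pose omega i : {additive B -> int^o} := HB.pack_for {additive B -> int^o}
  (fun c => (iB c *m invmx U) 0 i : int^o)
  (GRing.isNmodMorphism.Build B int^o _ (omegaP i)).
exists n, (fun i => pB (row i U)), omega, delta.
have SE (x : 'rV[int]_m) i :
    (x *m \matrix_(i < m, j < n) (s`_i *+ (i == j :> nat))) 0 i =
    if insub (i : nat) is Some k then x 0 k * delta i else 0.
  rewrite mxE; case: insubP => [k km kE|im].
    rewrite (bigD1 k)//= big1 => [|j jk]; last first.
      rewrite mxE -kE; case: eqP => [e|]; last by rewrite mulr0.
      by case/eqP: jk; apply: val_inj.
    by rewrite addr0 mxE kE eqxx /delta km.
  rewrite big1// => j _; rewrite mxE; case: eqP => [e|]; last by rewrite mulr0.
  by move: im; rewrite -e ltn_ord.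
split=> [c|i a|i].
- rewrite -[LHS]BK -[iB c](mulmxKV Uu) mulmx_sum_row raddf_sum.
  by apply: eq_bigr => i _; rewrite -[X in X *: _]intz scaler_int raddfMz.
- have -> : omega i (d a) = (iA a *m L *m
      \matrix_(i < m, j < n) (s`_i *+ (i == j :> nat))) 0 i.
    rewrite /= -{1}[a]AK; have -> : iB (d (pA (iA a))) = iA a *m M by rewrite -ME.
    by rewrite ME' !mulmxA mulmxK.
  by rewrite SE; case: insub => [k|]; rewrite ?dvdz0// dvdz_mull.
- case: (ltnP i m) => im; last first.
    by exists 0; rewrite raddf0 /delta ltnNge im mulr0z.
  exists (pA (row (Ordinal im) (invmx L))).
  rewrite -[LHS]BK; have -> x : iB (d (pA x)) = x *m M by rewrite -ME.
  rewrite -raddfMz -scaler_int intz; congr (pB _).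
  rewrite ME' -row_mul !mulmxA mulVmx// mul1mx row_mul [row i U]rowE.
  rewrite scalemxAl; congr (_ *m _); apply/rowP => j; rewrite !mxE eqxx /=.
  by rewrite /delta im eq_sym -val_eqE /=; case: eqP => _; rewrite ?mulr1 ?mulr0.
Qed.

(** All that is needed of a ring in order to eliminate a redundant generator.  It
    holds for the integers, by Smith normal form, and for fields, by Gaussian
    elimination. *)
Definition row_completable (A : comUnitRingType) : Prop :=
  forall (n : nat) (c : 'rV[A]_n.+1), c != 0 ->
  exists (k : A) (U : 'M[A]_n.+1), [/\ k != 0, U \in unitmx & c = k *: row 0 U].

Lemma int_row_completable : row_completable int.
Proof.
move=> n c c0; have [L _ [U Uu [s _ cE]]] := int_Smith_normal_form c.
have cE' : c = (L 0 0 * s`_0) *: row 0 U.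
  rewrite cE; apply/rowP => j; rewrite !mxE big_ord_recl big1 => [|i _].
    by rewrite !mxE big_ord1 mxE addr0.
  by rewrite !mxE big_ord1 mxE mulr0 mul0r.
exists (L 0 0 * s`_0), U; split=> //.
by apply: contraNneq c0 => k0; rewrite cE' k0 scale0r.
Qed.

Lemma field_row_completable (F : fieldType) : row_completable F.
Proof.
move=> n c c0; have := mulmx_ebase c; set L := col_ebase c; set U := row_ebase c.
rewrite rank_rV c0 => cE; have cE' : c = L 0 0 *: row 0 U.
  rewrite -{1}cE; apply/rowP => j; rewrite !mxE big_ord_recl big1 => [|i _].
    by rewrite !mxE big_ord1 mxE mulr1 addr0.
  by rewrite !mxE big_ord1 mxE mulr0 mul0r.
exists (L 0 0), U; split=> //; last exact: row_ebase_unit.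
by apply: contraNneq c0 => k0; rewrite cE' k0 scale0r.
Qed.

(** Induction on the number of generators.  If there is a relation with coefficients
    c = k (row 0 of U), the absence of torsion allows division by k; after the
    change of generators by U, the first one is zero. *)
Lemma generated_has_basis (A : comUnitRingType) (V : lmodType A) (n : nat)
    (g : 'I_n -> V) :
  row_completable A -> (forall (k : A) (x : V), k != 0 -> k *: x = 0 -> x = 0) ->
  (forall x, exists c : 'rV[A]_n, x = \sum_i c 0 i *: g i) ->
  exists (b : nat) (e : 'I_b -> V), is_basis e.
Proof.
move=> compl tf; elim: n g => [|n IH] g gen.
  exists 0%N, g; exists (fun=> 0) => [c|x]; first by apply/rowP => -[].
  by have [c ->] := gen x; rewrite !big_ord0.
have [[c c0 cg]|free] :=
    pselect (exists2 c : 'rV[A]_n.+1, c != 0 & \sum_i c 0 i *: g i = 0).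
  have [k [U [k0 Uu cE]]] := compl _ _ c0.
  pose g' i := \sum_j U i j *: g j.
  have g'0 : g' 0 = 0.
    apply: (tf k) => //; rewrite -cg scaler_sumr; apply: eq_bigr => i _.
    by rewrite scalerA cE !mxE.
  apply: (IH (fun i => g' (lift 0 i))) => x; have [a ->] := gen x.
  exists (\row_i (a *m invmx U) 0 (lift 0 i)).
  transitivity (\sum_i (a *m invmx U) 0 i *: g' i); last first.
    rewrite big_ord_recl g'0 scaler0 add0r.
    by apply: eq_bigr => i _; rewrite [in RHS]mxE.
  rewrite -{1}[a](mulmxKV Uu); under [RHS]eq_bigr do rewrite scaler_sumr.
  rewrite exchange_big /=; apply: eq_bigr => j _; rewrite mxE scaler_suml.
  by apply: eq_bigr => i _; rewrite scalerA.
have /choice[h hP] := gen; exists n.+1, g, h => [c|x]; last by rewrite -hP.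
apply/eqP; rewrite -subr_eq0; apply/negP => /negP ne; apply: free.
exists (h (\sum_i c 0 i *: g i) - c) => //.
by under eq_bigr do rewrite !mxE scalerBl; rewrite sumrB -hP subrr.
Qed.

(** If S is not 0, polarization gives a vector v with S(v, v) not 0; in a basis
    starting with a multiple of v, clearing the first row and column reduces the
    dimension. *)
Lemma symmetric_diagonalizable (F : fieldType) (n : nat) (S : 'M[F]_n) :
  (2 : F) != 0 -> S^T = S ->
  exists2 P : 'M[F]_n, P \in unitmx & is_diag_mx (P^T *m S *m P).
Proof.
move=> two0; suff h : S^T = S ->
    exists2 P : 'M[F]_n, P \in unitmx & is_diag_mx (P *m S *m P^T).
  move=> /h[P Pu Pd]; exists P^T; rewrite ?unitmx_tr//.
  by rewrite trmxK.
elim: n S => [|n IH] S ST.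
  by exists 1%:M; rewrite ?unitmx1//; apply/is_diag_mxP => -[].
have [->|S0] := eqVneq S 0.
  by exists 1%:M; rewrite ?unitmx1// mulmx0 mul0mx mx0_is_diag.
have [v vv] : exists v : 'rV_n.+1, bform S v v != 0.
  apply: contrapT => /forallNP h; case/negP: S0; apply/eqP/matrixP => i j.
  have h0 v : bform S v v = 0 by have /negP := h v; rewrite negbK => /eqP.
  have /eqP := qformD (delta_mx 0 i) (delta_mx 0 j) ST.
  rewrite !h0 !add0r eq_sym mulf_eq0 (negbTE two0) /= => /eqP.
  by rewrite /bform -rowE trmx_delta -colE !mxE.
have v0 : v != 0 by apply: contraNneq vv => ->; rewrite /bform !mul0mx mxE.
have [k [U [k0 Uu vE]]] := field_row_completable v0.
pose T : 'M[F]_(1 + n) := U *m S *m U^T.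
have TT : T^T = T by rewrite /T !trmx_mul trmxK ST mulmxA.
have T0 : T 0 0 != 0.
  have TE : bform S (row 0 U) (row 0 U) = T 0 0.
    rewrite /bform /T -row_mul [LHS]mxE [RHS]mxE; apply: eq_bigr => i _.
    by congr (_ * _); rewrite !mxE.
  by apply: contraNneq vv => T0; rewrite vE bformZl bformZr TE T0 !mulr0.
pose c := dlsubmx T; pose X := - (T 0 0)^-1 *: c.
have TE : T = block_mx (T 0 0)%:M c^T c (drsubmx T).
  rewrite -[LHS]submxK; congr block_mx; last by rewrite /c trmx_dlsub TT.
  rewrite [LHS]mx11_scalar; congr _%:M; rewrite 2![LHS]mxE.
  by congr (T _ _); apply: val_inj.
pose T' := X *m c^T + drsubmx T.
have T'T : T'^T = T'.
  rewrite linearD /= trmx_mul trmxK trmx_drsub TT; congr (_ + _).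
  by rewrite /X linearZ /= -scalemxAl -scalemxAr.
have [P Pu Pd] := IH T' T'T.
pose E : 'M[F]_(1 + n) := block_mx 1%:M 0 X 1%:M.
pose Q : 'M[F]_(1 + n) := block_mx 1%:M 0 0 P.
have ETE : E *m T *m E^T = block_mx (T 0 0)%:M 0 0 T'.
  rewrite [X in E *m X]TE tr_block_mx !mulmx_block !trmx1 !trmx0 !mul0mx !mulmx0 !mulmx1.
  rewrite !mul1mx !addr0.
  have -> : X *m (T 0 0)%:M + c = 0.
    by rewrite mul_mx_scalar scalerA mulrN divff// scaleN1r addNr.
  have -> : (T 0 0)%:M *m X^T + c^T = 0.
    by rewrite mul_scalar_mx linearZ scalerA mulrN divff// scaleN1r addNr.
  by rewrite !mul0mx add0r.
exists (Q *m E *m U).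
  have Qu : Q \in unitmx by rewrite unitmxE det_ublock det1 mul1r -unitmxE.
  have Eu : E \in unitmx by rewrite unitmxE det_lblock !det1 mulr1 unitr1.
  by rewrite !unitmx_mul Uu andbT; apply/andP.
have -> : Q *m E *m U *m S *m (Q *m E *m U)^T = Q *m (E *m T *m E^T) *m Q^T.
  by rewrite /T !trmx_mul !mulmxA.
rewrite ETE tr_block_mx !mulmx_block !trmx1 !trmx0 !mul0mx !mulmx0 !mulmx1.
rewrite !mul1mx !addr0 !add0r !mul0mx.
apply/is_diag_mxP => i j.
case: (@split_ordP 1 n i) => i' ->; case: (@split_ordP 1 n j) => j' ->.
- by rewrite (@block_mxEul _ 1 n 1 n) !ord1 eqxx.
- by rewrite (@block_mxEur _ 1 n 1 n) mxE.
- by rewrite (@block_mxEdl _ 1 n 1 n) mxE.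
- rewrite (@block_mxEdr _ 1 n 1 n) /= eqn_add2l => ij; exact: (is_diag_mxP Pd).
Qed.

(** * The Pontryagin square on cochains *)

Section Evaluation.
Variables (C : chain_complex) (t : tensor_chain C) (p q : int).
Implicit Types (a : cochain C int p) (b : cochain C int q).

Lemma tensor_evDl a a' b : tensor_ev t (a + a') b = tensor_ev t a b + tensor_ev t a' b.
Proof. by rewrite /tensor_ev !raddfD. Qed.

Lemma tensor_evDr a b b' : tensor_ev t a (b + b') = tensor_ev t a b + tensor_ev t a b'.
Proof. by []. Qed.

Lemma tensor_evNl a b : tensor_ev t (- a) b = - tensor_ev t a b.
Proof. by rewrite /tensor_ev !raddfN. Qed.

Lemma tensor_evNr a b : tensor_ev t a (- b) = - tensor_ev t a b.
Proof. by []. Qed.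

Lemma tensor_ev0l b : tensor_ev t (0 : cochain C int p) b = 0.
Proof. by rewrite /tensor_ev !raddf0. Qed.

Lemma tensor_ev0r a : tensor_ev t a (0 : cochain C int q) = 0.
Proof. by []. Qed.

Lemma tensor_evMnl a b k : tensor_ev t (a *+ k) b = tensor_ev t a b *+ k.
Proof. by elim: k => [|k IH]; rewrite ?tensor_ev0l// !mulrS tensor_evDl IH. Qed.

Lemma tensor_evMnr a b k : tensor_ev t a (b *+ k) = tensor_ev t a b *+ k.
Proof. by elim: k => [|k IH]; rewrite ?tensor_ev0r// !mulrS tensor_evDr IH. Qed.
End Evaluation.

Lemma codif_codif (C : chain_complex) (A : comNzRingType) (i j k : int)
  (f : cochain C A i) : codif k (codif j f) = 0.
Proof.
apply/homP => x.
by rewrite -[LHS]/(f (dif C j i (dif C k j x))) dif_dif raddf0.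
Qed.

Section Codif.
Variables (C : chain_complex) (A : comNzRingType) (i j : int).
Implicit Types f g : cochain C A i.

Lemma codifD f g : codif j (f + g) = codif j f + codif j g.
Proof. exact: raddfD. Qed.

Lemma codifN f : codif j (- f) = - codif j f.
Proof. exact: raddfN. Qed.

Lemma codifMn f n : codif j (f *+ n) = codif j f *+ n.
Proof. exact: raddfMn. Qed.

Lemma codif0 : codif j (0 : cochain C A i) = 0.
Proof. exact: raddf0. Qed.
End Codif.

Section SymIdentities.
Variables (C : chain_complex) (n : int) (phi : symmetric_structure n C).

(** In this lemma and the next, the degrees p + 1 and r + 1 are variables subject to
    an equation, since for instance (2k - 1) + 1 does not reduce to 2k. *)
Lemma sym_cycle0 (p r p1 r1 : int) (a : cochain C int p) (b : cochain C int r) :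
  p1 = p + 1 -> r1 = r + 1 -> p + r = n - 1 ->
  tensor_ev (phi 0%N) a (codif r1 b) + (-1) ^ r * tensor_ev (phi 0%N) (codif p1 a) b = 0.
Proof.
move=> -> -> pr; have := @sym_cycle _ _ phi 0 p r; rewrite addr0 => /(_ pr a b).
by rewrite mulr0 addr0.
Qed.

Lemma sym_cycleS (s : nat) (p r p1 r1 : int) (a : cochain C int p) (b : cochain C int r) :
  p1 = p + 1 -> r1 = r + 1 -> p + r = n + s%:Z ->
  tensor_ev (phi s.+1) a (codif r1 b)
    + (-1) ^ r * tensor_ev (phi s.+1) (codif p1 a) b
    + (-1) ^ (n + s%:Z) * (tensor_ev (phi s) a b
       + (-1) ^ s.+1%:Z * (-1) ^ (p * r) * tensor_ev (phi s) b a) = 0.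
Proof.
move=> -> -> pr; have e : n + s.+1%:Z - 1 = n + s%:Z by lia.
have := @sym_cycle _ _ phi s.+1 p r; rewrite e => /(_ pr a b).
by rewrite -[_ * _ * tensor_ev _ b a]mulrA.
Qed.
End SymIdentities.

Section MiddleForm.
Variables (C : chain_complex) (k : nat) (phi : symmetric_structure (4 * k%:Z) C).
Local Notation m := (2 * k%:Z).
Local Notation ev s a b := (tensor_ev (phi s%N) a b).
Local Notation coch r := (cochain C int r).
Implicit Types (a b v w : coch m).

Let expN1_even (i : int) : (-1) ^ (2 * i) = 1 :> int.
Proof. by rewrite -exprz_exp -exprnP sqrrN !expr1n exp1rz. Qed.

Let expN1_odd (i : int) : (-1) ^ (2 * i + 1) = -1 :> int.
Proof. by rewrite exprzDr// expN1_even mul1r expr1z. Qed.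

Lemma phi0_codifr a (w : coch (m - 1)) :
  ev 0 a (codif m w) = ev 0 (codif (m + 1) a) w.
Proof.
have := @sym_cycle0 _ _ phi m (m - 1) (m + 1) m a w.
have sgn : (-1) ^ (m - 1) = -1 :> int.
  by rewrite -(expN1_odd (k%:Z - 1)); congr (_ ^ _); lia.
rewrite subrK sgn mulN1r => /(_ erefl erefl _) h.
by apply/eqP; rewrite -subr_eq0 h//; lia.
Qed.

Lemma phi0_codifl (w : coch (m - 1)) b :
  ev 0 (codif m w) b = - ev 0 w (codif (m + 1) b).
Proof.
have := @sym_cycle0 _ _ phi (m - 1) m m (m + 1) w b.
rewrite subrK expN1_even mul1r => /(_ erefl erefl _) h.
by apply/eqP; rewrite -addr_eq0 addrC h//; lia.
Qed.

Lemma phi0_sym a b :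
  ev 0 b a = ev 0 a b + ev 1 a (codif (m + 1) b) + ev 1 (codif (m + 1) a) b.
Proof.
have := @sym_cycleS _ _ phi 0 m m (m + 1) (m + 1) a b erefl erefl.
have sgn : (-1) ^ (m * m) = 1 :> int.
  by rewrite -(expN1_even (k%:Z * m)); congr (_ ^ _); lia.
have sgn' : (-1) ^ (4 * k%:Z + 0%N) = 1 :> int.
  by rewrite -(expN1_even m); congr (_ ^ _); lia.
rewrite sgn sgn' expN1_even expr1z !mul1r mulr1 mulN1r => h.
by have := h ltac:(lia); lia.
Qed.

Lemma phi1_sym a b :
  ev 1 b (codif (m + 1) a) + ev 1 (codif (m + 1) a) b =
    - ev 2 (codif (m + 1) b) (codif (m + 1) a).
Proof.
have := @sym_cycleS _ _ phi 1 m (m + 1) (m + 1) (m + 1 + 1) b (codif (m + 1) a) erefl erefl.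
have sgn : (-1) ^ (m * (m + 1)) = 1 :> int.
  by rewrite -(expN1_even (k%:Z * (m + 1))); congr (_ ^ _); lia.
have sgn' : (-1) ^ (4 * k%:Z + 1%N) = -1 :> int.
  by rewrite -(expN1_odd m); congr (_ ^ _); lia.
rewrite codif_codif tensor_ev0r sgn sgn' expN1_odd !mulr1.
rewrite [(-1) ^ 2%:Z](_ : _ = 1) ?mul1r// => h.
by have := h ltac:(lia); lia.
Qed.

(** If v lifts a cocycle modulo 2, with d^* v = 2 u, then
    phi_1(v, d^* v) = 2 phi_1(v, u). *)
Definition pontryagin_form v : int := ev 0 v v + ev 1 v (codif (m + 1) v).

(** Integral lifts of the cocycles modulo 2. *)
Definition mod2_cocycle v := exists u : coch (m + 1), codif (m + 1) v = u *+ 2.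

(** Integral lifts of the coboundaries modulo 2. *)
Definition mod2_coboundary v :=
  exists (w : coch (m - 1)) (x : coch m), v = codif m w + x *+ 2.

Lemma mod2_coboundary_cocycle v : mod2_coboundary v -> mod2_cocycle v.
Proof.
move=> [w [x ->]]; exists (codif (m + 1) x).
by rewrite codifD codif_codif add0r codifMn.
Qed.

Lemma mod2_cocycleD v w : mod2_cocycle v -> mod2_cocycle w -> mod2_cocycle (v + w).
Proof. by move=> [u vu] [u' wu']; exists (u + u'); rewrite raddfD /= vu wu' mulrnDl. Qed.

(** By the relations for s = 1 and s = 2, the difference is
    2 phi_1(v, d^* w) - phi_2(d^* w, d^* v), and both d^* v and d^* w are even. *)
Lemma pontryagin_formD v w : mod2_cocycle v -> mod2_cocycle w ->
  (4 %| pontryagin_form (v + w)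
        - (pontryagin_form v + pontryagin_form w + 2 * ev 0 v w))%Z.
Proof.
move=> [u vu] [u' wu']; rewrite /pontryagin_form codifD.
rewrite !tensor_evDl !tensor_evDr (phi0_sym v w).
have := phi1_sym v w; rewrite vu wu' !tensor_evMnr !tensor_evMnl => h.
apply/dvdzP; exists (ev 1 v u' - ev 2 u' u); lia.
Qed.

Lemma phi0_mod2_sym v w : mod2_cocycle v -> mod2_cocycle w ->
  (2 %| ev 0 w v - ev 0 v w)%Z.
Proof.
move=> [u vu] [u' wu']; rewrite phi0_sym vu wu' !tensor_evMnr !tensor_evMnl.
by apply/dvdzP; exists (ev 1 v u' + ev 1 u w); lia.
Qed.

Lemma phi0_mod2_coboundary v w : mod2_coboundary v -> mod2_cocycle w ->
  (2 %| ev 0 v w)%Z.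
Proof.
move=> [v' [x ->]] [u wu]; rewrite tensor_evDl phi0_codifl wu tensor_evMnl tensor_evMnr.
by apply/dvdzP; exists (ev 0 x w - ev 0 v' u); lia.
Qed.

Lemma pontryagin_form_coboundary v : mod2_coboundary v -> (4 %| pontryagin_form v)%Z.
Proof.
move=> [w [x ->]].
have cw : mod2_cocycle (codif m w) by exists 0; rewrite codif_codif mul0rn.
have cx : mod2_cocycle (x *+ 2) by exists (codif (m + 1) x); rewrite codifMn.
have /dvdzP[e eE] := pontryagin_formD cw cx.
have Q1 : pontryagin_form (codif m w) = 0.
  by rewrite /pontryagin_form phi0_codifl codif_codif !tensor_ev0r.
have Q2 : pontryagin_form (x *+ 2) = 4 * pontryagin_form x.
  rewrite /pontryagin_form codifMn !tensor_evMnl !tensor_evMnr; lia.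
move: eE; rewrite Q1 Q2 tensor_evMnr => eE; apply/dvdzP.
exists (e + pontryagin_form x + ev 0 (codif m w) x).
rewrite -[LHS](subrK (0 + 4 * pontryagin_form x + 2 * (ev 0 (codif m w) x *+ 2))).
by rewrite eE; ring.
Qed.
End MiddleForm.

(** * Cohomology modulo 2 *)

Section HomEval.
Variables U V : zmodType.

Lemma hom_sumE (I : Type) (r : seq I) (F : I -> {additive U -> V}) x :
  (\sum_(i <- r) F i) x = \sum_(i <- r) F i x.
Proof.
by apply: (big_morph (fun f : {additive U -> V} => f x)).
Qed.

Lemma homMnE (f : {additive U -> V}) n x : (f *+ n) x = f x *+ n.
Proof. by elim: n => // n IH; rewrite !mulrS homDE IH. Qed.
End HomEval.

Lemma additive_divide (V : zmodType) (N : int) (v : {additive V -> int^o}) :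
  (forall y, (N %| v y)%Z) -> exists x : {additive V -> int^o}, v = N *: x.
Proof.
have [->|N0] := eqVneq N 0 => vN.
  exists 0; apply/homP => y; have := vN y; rewrite dvd0z homZE scale0r.
  by move=> /eqP.
pose h y : int^o := (v y %/ N)%Z.
have hE y : h y * N = v y by rewrite /h divzK.
have h_mor : nmod_morphism h.
  split=> [|x y]; apply: (@mulIf _ N) => //; first by rewrite hE raddf0 mul0r.
  by rewrite mulrDl !hE raddfD.
exists (HB.pack_for {additive V -> int^o} h
  (GRing.isNmodMorphism.Build V int^o _ h_mor)).
by apply/homP => y; rewrite homZE /= -hE mulrC.
Qed.

Section Mod2Reduction.
Variable (V : zmodType).

Lemma additive_halve (v : {additive V -> int^o}) :
  (forall y, (2 %| v y)%Z) -> exists x : {additive V -> int^o}, v = x *+ 2.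
Proof. by move=> /additive_divide[x ->]; exists x; exact: scaler_nat. Qed.

Lemma mod2_is_additive (v : {additive V -> int^o}) :
  nmod_morphism (fun y => (v y)%:~R : ('F_2)^o).
Proof. by split=> [|x y]; rewrite ?raddf0// raddfD intrD. Qed.

Definition mod2 (v : {additive V -> int^o}) : {additive V -> ('F_2)^o} :=
  HB.pack_for {additive V -> ('F_2)^o} (fun y => (v y)%:~R : ('F_2)^o)
    (GRing.isNmodMorphism.Build V ('F_2)^o _ (mod2_is_additive v)).

Lemma mod2E v y : mod2 v y = (v y)%:~R. Proof. by []. Qed.

Lemma mod2D v w : mod2 (v + w) = mod2 v + mod2 w.
Proof. by apply/homP => y; rewrite mod2E !homDE intrD. Qed.

Lemma mod2N v : mod2 (- v) = - mod2 v.
Proof. by apply/homP => y; rewrite mod2E !homNE intrN. Qed.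

Lemma intr_F2_eq0 (k : int) : ((k%:~R : 'F_2) == 0) = (2 %| k)%Z.
Proof. exact: (@intr_Zp_eq0 2). Qed.

Lemma mod2_eq0 v : mod2 v = 0 -> exists x, v = x *+ 2.
Proof.
move=> v0; apply: additive_halve => y.
by rewrite -intr_F2_eq0 -mod2E v0.
Qed.

Lemma mod2_double v : mod2 (v *+ 2) = 0.
Proof.
apply/homP => y; apply/eqP; rewrite mod2E intr_F2_eq0 homMnE.
by apply/dvdzP; exists (v y); lia.
Qed.

Lemma mod2_lift (f : {additive V -> ('F_2)^o}) : fg_projective V ->
  exists v, f = mod2 v.
Proof.
move=> pV; have [n [beta [omega [_ [coord _ _]]]]] :=
  @smith_coordinates V V \0 pV pV.
exists (\sum_i omega i *+ (f (beta i) : nat)).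
apply/homP => y; rewrite mod2E {1}(coord y) raddf_sum hom_sumE rmorph_sum.
apply: eq_bigr => i _; rewrite raddfMz homMnE -mulr_natl rmorphM /= -mulrzl.
by rewrite mulrC natz -pmulrn natr_Zp.
Qed.
End Mod2Reduction.

Section Representatives.
Variables (C : chain_complex) (k : nat).
Hypothesis C_projective : forall r : int, fg_projective (C r).
Local Notation m := (2 * k%:Z).
Local Notation coch r := (cochain C int r).
Implicit Types (v w : coch m) (x y : H_mod2 C k).

(** Statements on classes are proved for all their lifts v; the chosen lift
    [mod2_rep] is one of them. *)
Definition lifts x v := exists c : cocycle C 'F_2 m,
  cohom_class c = x /\ cocycle_val c = mod2 v.

Lemma codif_mod2 (i j : int) (v : coch i) : codif j (mod2 v) = mod2 (codif j v).
Proof. exact/homP. Qed.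

Lemma codif_mod2_eq0 (i j : int) (v : coch i) : codif j (mod2 v) = 0 ->
  exists u : coch j, codif j v = u *+ 2.
Proof. by rewrite codif_mod2 => /mod2_eq0. Qed.

Lemma lifts_cocycle x v : lifts x v -> mod2_cocycle v.
Proof.
move=> [c [_ cE]]; apply: codif_mod2_eq0.
by have /eqP := cocycleP c; rewrite cE.
Qed.

Lemma double_inj (V : zmodType) (u v : {additive V -> int^o}) :
  u *+ 2 = v *+ 2 -> u = v.
Proof.
move=> e; apply/homP => y; have := congr1 (fun f : {additive V -> int^o} => f y) e.
by rewrite !homMnE => e'; apply: (@mulIf _ (2 : int)) => //; lia.
Qed.

Lemma represents_lifts x u v : represents x (u, v) <->
  lifts x v /\ codif (m + 1) v = u *+ 2.
Proof.
split=> [[/= e _ [c [cx cE]]]|[[c [cx cE]] e]].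
  by split=> //; exists c; split=> //; apply/homP.
split=> //=; last by exists c; split=> // y; rewrite cE.
apply: double_inj; rewrite mul0rn -codifMn -e.
exact: codif_codif.
Qed.

Lemma mod2_cocycle_lifts v : mod2_cocycle v -> exists x, lifts x v.
Proof.
move=> [u vu]; have cP : mod2 v \in @cocycle_pred C 'F_2 m.
  by rewrite inE codif_mod2 vu mod2_double.
by exists (cohom_class (Cocycle cP)), (Cocycle cP).
Qed.

Lemma lifts_ex x : exists v, lifts x v.
Proof.
pose c : cocycle C 'F_2 m := repr (x : cohomology C 'F_2 m).
have [v vE] := mod2_lift (cocycle_val c) (C_projective m).
by exists v, c; split=> //; rewrite /cohom_class reprK.
Qed.

Lemma cohom_class_eqP (A : comNzRingType) r (c c' : cocycle C A r) :
  cohom_class c = cohom_class c' <->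
  exists g : cochain C A (r - 1), cocycle_val c = cocycle_val c' + codif r g.
Proof.
split=> [/lquot_eqP/asboolP[g gE]|[g gE]].
  by exists g; rewrite -gE addrC; rewrite -[LHS](subrK (cocycle_val c')).
by apply/lquot_eqP/asboolP; exists g; rewrite /= gE addrC addKr.
Qed.

Lemma lifts_coboundary x v v' : lifts x v -> lifts x v' -> mod2_coboundary (v - v').
Proof.
move=> [c [<- cE]] [c' [/esym/cohom_class_eqP[g gE] cE']].
have [w wE] := mod2_lift g (C_projective _).
have : mod2 (v - v' - codif m w) = 0.
  rewrite !mod2D !mod2N -cE -cE' gE wE codif_mod2; apply/eqP.
  by rewrite subr_eq0 addrAC subrr add0r.
by move=> /mod2_eq0[z zE]; exists w, z; rewrite -zE [RHS]addrC subrK.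
Qed.

Lemma lifts_coboundaryD x v w : lifts x v -> mod2_coboundary w -> lifts x (v + w).
Proof.
move=> xv [w' [z wE]]; have vw : mod2_cocycle (v + w).
  apply: mod2_cocycleD; first exact: lifts_cocycle xv.
  by apply: mod2_coboundary_cocycle; exists w', z.
have [y [c [cy cE]]] := mod2_cocycle_lifts vw.
move: xv => [c' [c'x cE']]; exists c; split=> //; rewrite -c'x.
apply/cohom_class_eqP; exists (mod2 w').
by rewrite cE cE' codif_mod2 wE [LHS]mod2D [X in _ + X]mod2D mod2_double addr0.
Qed.

Lemma lifts0 v : mod2_coboundary v -> lifts 0 v.
Proof.
move=> vb; rewrite -[v]add0r; apply: lifts_coboundaryD => //.
by exists 0; split; [exact: raddf0|apply/homP => y; rewrite mod2E].
Qed.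

Lemma liftsD x y v w : lifts x v -> lifts y w -> lifts (x + y) (v + w).
Proof.
move=> [c [<- cE]] [c' [<- cE']]; exists (c + c'); split; first exact: raddfD.
by rewrite mod2D -cE -cE'.
Qed.

Lemma liftsN x v : lifts x v -> lifts (- x) (- v).
Proof.
move=> [c [<- cE]]; exists (- c); split; first exact: raddfN.
by rewrite mod2N -cE.
Qed.

Lemma lifts_eq x y v : lifts x v -> lifts y v -> x = y.
Proof.
move=> [c [<- cE]] [c' [<- cE']]; apply/cohom_class_eqP; exists 0.
by rewrite codif0 addr0 cE cE'.
Qed.

Lemma mod2_rep_lifts x : lifts x (mod2_rep x).2 /\
  codif (m + 1) (mod2_rep x).2 = (mod2_rep x).1 *+ 2.
Proof.
have [v xv] := lifts_ex x; have [u vu] := lifts_cocycle xv.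
have /= : represents x (mod2_rep x).
  apply: (@xgetPex _ (0, 0) [set uv | represents x uv]%classic).
  by exists (u, v); apply/represents_lifts.
by case: (mod2_rep x) => u' v' /represents_lifts.
Qed.
End Representatives.

Section FormsOnReps.
Variables (C : chain_complex) (k : nat) (phi : symmetric_structure (4 * k%:Z) C).
Hypothesis C_projective : forall r : int, fg_projective (C r).
Local Notation m := (2 * k%:Z).
Local Notation ev s a b := (tensor_ev (phi s%N) a b).
Implicit Types (v w : cochain C int m) (x y : H_mod2 C k).

Lemma eq_F2 (a b : int) : (2 %| a - b)%Z -> a%:~R = b%:~R :> 'F_2.
Proof. by rewrite -intr_F2_eq0 intrB subr_eq0 => /eqP. Qed.

Lemma eq_Z4 (a b : int) : (4 %| a - b)%Z -> a%:~R = b%:~R :> 'Z_4.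
Proof. by rewrite -(@intr_Zp_eq0 4)// intrB subr_eq0 => /eqP. Qed.

Lemma phi0_even_r v w : mod2_cocycle v -> mod2_coboundary w -> (2 %| ev 0 v w)%Z.
Proof.
move=> cv bw; have cw := mod2_coboundary_cocycle bw.
have := phi0_mod2_sym phi cw cv; have := phi0_mod2_coboundary phi bw cv.
by move=> h1 h2; have := rpredD h1 h2; rewrite addrC subrK.
Qed.

Lemma mod2_formE x y v w : lifts x v -> lifts y w ->
  mod2_form phi x y = (ev 0 v w)%:~R.
Proof.
move=> xv yw; have [xv' _] := mod2_rep_lifts C_projective x.
have [yw' _] := mod2_rep_lifts C_projective y; rewrite /mod2_form.
move: (mod2_rep x).2 (mod2_rep y).2 xv' yw' => v' w' xv' yw'; apply: eq_F2.
have b1 := lifts_coboundary C_projective xv' xv.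
have b2 := lifts_coboundary C_projective yw' yw.
have := rpredD (phi0_mod2_coboundary phi b1 (lifts_cocycle yw'))
  (phi0_even_r (lifts_cocycle xv) b2).
by rewrite tensor_evDl tensor_evDr tensor_evNl tensor_evNr addrA subrK.
Qed.

Lemma pontryagin_squareE x v : lifts x v ->
  pontryagin_square phi x = (pontryagin_form phi v)%:~R.
Proof.
move=> xv; have [xv' e] := mod2_rep_lifts C_projective x.
rewrite /pontryagin_square; case: (mod2_rep x) xv' e => u' v' /= xv' e.
transitivity ((pontryagin_form phi v')%:~R : 'Z_4).
  by rewrite /pontryagin_form e tensor_evMnr intrD rmorphMn.
have b := lifts_coboundary C_projective xv' xv; apply: eq_Z4.
have cv := lifts_cocycle xv.
have := pontryagin_formD phi cv (mod2_coboundary_cocycle b).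
have -> : v + (v' - v) = v' by rewrite addrC subrK.
have /dvdzP[e1 ->] := pontryagin_form_coboundary phi b.
have /dvdzP[e2 ->] := phi0_even_r cv b.
by move=> /dvdzP[e3 h]; apply/dvdzP; exists (e3 + e1 + e2); lia.
Qed.

Lemma pontryagin_enhancement :
  quadratic_enhancement (mod2_form phi) (pontryagin_square phi).
Proof.
move=> x y; have [v xv] := lifts_ex C_projective x.
have [w yw] := lifts_ex C_projective y.
rewrite (mod2_formE xv yw) (pontryagin_squareE (liftsD xv yw)).
rewrite (pontryagin_squareE xv) (pontryagin_squareE yw).
have -> : (((ev 0 v w)%:~R : 'F_2) : nat)%:R *+ 2 = (2 * ev 0 v w)%:~R :> 'Z_4.
  have <- : (2 * (((ev 0 v w)%:~R : 'F_2) : nat)%:Z)%:~R = (2 * ev 0 v w)%:~R :> 'Z_4.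
    apply: eq_Z4; set a : int := ev 0 v w.
    have /dvdzP[e eE] : (2 %| ((a%:~R : 'F_2) : nat)%:Z - a)%Z.
      by rewrite -intr_F2_eq0 intrB -pmulrn natr_Zp subrr.
    by rewrite -mulrBr eE; apply/dvdzP; exists e; ring.
  by move: (_%:~R : 'F_2) => u; rewrite intrM mulr_natl.
rewrite -!intrD; apply: eq_Z4.
exact: pontryagin_formD (lifts_cocycle xv) (lifts_cocycle yw).
Qed.

Lemma mod2_form_sym x y : mod2_form phi x y = mod2_form phi y x.
Proof.
have [v xv] := lifts_ex C_projective x; have [w yw] := lifts_ex C_projective y.
rewrite (mod2_formE xv yw) (mod2_formE yw xv); apply: eq_F2.
exact: phi0_mod2_sym (lifts_cocycle yw) (lifts_cocycle xv).
Qed.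

Lemma mod2_formDr x y z : mod2_form phi x (y + z) = mod2_form phi x y + mod2_form phi x z.
Proof.
have [v xv] := lifts_ex C_projective x; have [w yw] := lifts_ex C_projective y.
have [t zt] := lifts_ex C_projective z.
rewrite (mod2_formE xv yw) (mod2_formE xv zt) (mod2_formE xv (liftsD yw zt)).
by rewrite tensor_evDr intrD.
Qed.
End FormsOnReps.

(** * Consequences of Poincare duality *)

Section PoincareInverse.
Variables (C : chain_complex) (n : int) (phi : symmetric_structure n C).
Hypothesis C_poincare : poincare phi.

(** In one degree, [gamma] is the homotopy inverse of phi_0 and [eta] a component of
    the homotopy.  The degrees are variables, as in [sym_cycle0]. *)
Lemma poincare_inverse (p q p1 q1 pm : int) :
  p + q = n -> p1 = p + 1 -> pm = p - 1 -> q1 = q + 1 ->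
  exists (gamma : {additive C q -> cochain C int p})
         (eta : {additive cochain C int p1 -> cochain C int p}),
  [/\ forall c, dif C q (q - 1) c = 0 -> codif p1 (gamma c) = 0,
      forall c : C q1, exists w : cochain C int pm, gamma (dif C q1 q c) = codif p w
    & forall v : cochain C int p, exists w : cochain C int pm,
        v = gamma (phi 0%N p q v) + codif p w + eta (codif p1 v)].
Proof.
move=> pq p1E pmE q1E.
have [_ [g [g_chain [h hP] _]]] := C_poincare.
have ? : p = n - q by lia. have ? : p1 = n - (q - 1) by lia.
have ? : pm = n - (q + 1) by lia.
clear p1E pmE pq; subst p p1 pm q1.
have sgnK (i : int) : (-1) ^ i * (-1) ^ i = 1 :> int.
  by case: i => j; rewrite /exprz ?invr_sign -expr2 sqrr_sign.
have sgnZ (i : int) (V : lmodType int) (x y : V) : (-1) ^ i *: x = y -> x = (-1) ^ i *: y.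
  by move=> <-; rewrite scalerA sgnK scale1r.
pose scale : {additive cochain C int (n - (q - 1)) -> cochain C int (n - (q - 1))} :=
  *:%R ((-1) ^ q : int).
pose h' : {additive cochain C int (n - (q - 1)) -> cochain C int (n - q)} :=
  h (q - 1) q.
exists (g q), (- (h' \o scale : {additive _ -> _})); split=> [c c0|c|v].
- have := g_chain q (q - 1) c; rewrite c0 raddf0.
  by move=> /esym/sgnZ ->; rewrite scaler0.
- exists ((-1) ^ (q + 1) *: g (q + 1) c); rewrite linearZ /=.
  exact: g_chain.
pose w : cochain C int (n - (q + 1)) := h q (q + 1) v.
exists (- ((-1) ^ (q + 1) *: w)).
have hv : g q (phi 0%N (n - q) q v) - v =
  (-1) ^ (q + 1) *: codif (n - q) w + h' (scale (codif (n - (q - 1)) v)) := hP q v.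
rewrite codifN linearZ /= -addrA -opprD;
have move_sub (V : zmodType) (x y z : V) : x - y = z -> y = x - z.
  by move=> <-; rewrite opprB addrC subrK.
exact: move_sub hv.
Qed.
End PoincareInverse.

Lemma fg_projective_torsion_free (V : zmodType) (x : V) (N : int) :
  fg_projective V -> N != 0 -> x *~ N = 0 -> x = 0.
Proof.
move=> pV N0 xN; have [n [beta [omega [_ [coord _ _]]]]] :=
  @smith_coordinates V V \0 pV pV.
rewrite [x]coord big1// => i _.
have : omega i x *~ N = 0 by rewrite -raddfMz xN raddf0.
by move=> /eqP; rewrite mulrz_eq0 (negbTE N0) /= => /eqP ->; rewrite mulr0z.
Qed.

Section Duality.
Variables (C : chain_complex) (k : nat) (phi : symmetric_structure (4 * k%:Z) C).
Hypothesis C_projective : forall r : int, fg_projective (C r).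
Hypothesis C_poincare : poincare phi.
Local Notation m := (2 * k%:Z).
Local Notation ev s a b := (tensor_ev (phi s%N) a b).
Local Notation coch r := (cochain C int r).
Implicit Types (v w z : coch m).

Lemma scale_intz (V : lmodType int) (a : int) (x : V) : a *: x = x *~ a.
Proof. by rewrite -scaler_int intz. Qed.

Lemma tensor_evZr (p q : int) (a : coch p) (b : coch q) (N : int) s :
  ev s a (N *: b) = N * ev s a b.
Proof. by []. Qed.

Lemma codifZ (i j : int) (a : coch i) (N : int) : codif j (N *: a) = N *: codif j a.
Proof. exact/homP. Qed.

Lemma scaleI (p : int) (a b : coch p) (N : int) : N != 0 -> N *: a = N *: b -> a = b.
Proof.
move=> N0 e; apply/homP => y; have := congr1 (fun f : coch p => f y) e.
by rewrite !homZE => /(mulfI N0).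
Qed.

Lemma dif_sum (i j : int) (n : nat) (F : 'I_n -> C j) (P : pred 'I_n) :
  (forall l, P l -> exists a, dif C i j a = F l) ->
  exists a, dif C i j a = \sum_(l | P l) F l.
Proof.
move=> h; elim/big_rec: _ => [|l x Pl [a <-]]; first by exists 0; rewrite raddf0.
by have [b <-] := h l Pl; exists (b + a); rewrite raddfD.
Qed.

(** In the coordinates of [smith_coordinates] for d : C_(2k+1) -> C_2k: if
    [delta i] is even, then [omega i] is a cocycle modulo 2, and by hypothesis the
    i-th coordinate of phi_0 v is even; if [delta i] is odd, then [beta i] is a
    boundary modulo 2.  So phi_0 v is a boundary modulo 2, and by duality v is a
    coboundary modulo 2. *)
Lemma mod2_nondegenerate v : mod2_cocycle v ->
  (forall w, mod2_cocycle w -> (2 %| ev 0 v w)%Z) -> mod2_coboundary v.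
Proof.
move=> [u vu] v_orth; pose c : C m := phi 0%N m m v.
have [n [beta [omega [delta [coord im bd]]]]] :=
  smith_coordinates (dif C (m + 1) m) (C_projective _) (C_projective _).
have [y [c' cE]] : exists y c', c = dif C (m + 1) m y + c' *+ 2.
  have split_term i : exists y c', beta i *~ omega i c = dif C (m + 1) m y + c' *+ 2.
    have [d2|d2] := boolP (2 %| delta i)%Z.
      have /v_orth/dvdzP[t tE] : mod2_cocycle (omega i).
        apply: additive_halve => a; exact: dvdz_trans d2 (im i a).
      exists 0, (beta i *~ t); rewrite raddf0 add0r -[omega i c]/(ev 0 v (omega i)) tE.
      by rewrite mulrzA pmulrn.
    have [a aE] := bd i.
    have [t tE] : exists t, delta i = 2 * t + 1.
      exists (delta i %/ 2)%Z; lia.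
    exists (a *~ omega i c), (- (beta i *~ (t * omega i c))).
    rewrite raddfMz aE -mulrzA tE mulNrn pmulrn -mulrzA -mulrzBr.
    by congr (_ *~ _); ring.
  rewrite [c]coord; elim/big_rec: _ => [|i x _ [y [c' ->]]].
    by exists 0, 0; rewrite raddf0 mul0rn addr0.
  have [y' [c'' ->]] := split_term i; exists (y' + y), (c'' + c').
  by rewrite raddfD mulrnDl addrACA.
have [gamma [eta [_ gam_bd gam_id]]] := @poincare_inverse _ _ _ C_poincare
  m m (m + 1) (m + 1) (m - 1) ltac:(lia) erefl erefl erefl.
have [w wE] := gam_id v; have [w' w'E] := gam_bd y.
exists (w' + w), (gamma c' + eta u).
have gE : gamma c = codif m w' + gamma c' *+ 2.
  by rewrite cE raddfD raddfMn w'E.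
rewrite [LHS]wE -/c gE vu [eta _]raddfMn codifD mulrnDl.
by rewrite [RHS]addrA; congr (_ + _); exact: addrAC.
Qed.

(** Let d^* v = 2 u, so that u represents the Bockstein of v; it has to be shown that
    u is a coboundary d^* x, for then v - 2 x is an integral cocycle.  In
    coordinates for d : C_2k -> C_(2k-1), d^* [omega i] = [delta i] t with t a
    torsion cocycle when [delta i] is not 0, and
    2 [omega i](phi_0 u) = phi_0(v, d^* [omega i]) = [delta i] phi_0(v, t) is
    divisible by 2 [delta i].  Thus phi_0 u is a boundary, and u a coboundary. *)
Lemma torsion_orthogonal_integral v : mod2_cocycle v ->
  (forall t (w : coch (m - 1)) (N : int), N != 0 -> N *: t = codif m w ->
     (2 %| ev 0 v t)%Z) ->
  exists2 z, codif (m + 1) z = 0 & mod2_coboundary (z - v).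
Proof.
move=> [u vu] v_orth.
have cu : codif (m + 1 + 1) u = 0.
  by apply: double_inj; rewrite mul0rn -codifMn -vu codif_codif.
pose c : C (m - 1) := phi 0%N (m + 1) (m - 1) u.
have [n [beta [omega [delta [coord im bd]]]]] :=
  smith_coordinates (dif C m (m - 1)) (C_projective _) (C_projective _).
have two_ev (w : coch (m - 1)) : ev 0 v (codif m w) = 2 * w c.
  by rewrite phi0_codifr vu tensor_evMnl [RHS]mulr_natl.
have [y cE] : exists y, dif C m (m - 1) y = c.
  rewrite [c]coord; apply: dif_sum => i _.
  have [t tE] : exists t, codif m (omega i) = delta i *: t.
    by apply: additive_divide => a; exact: im.
  have := two_ev (omega i); rewrite tE tensor_evZr.
  have [d0|d0] := eqVneq (delta i) 0.
    rewrite d0 mul0r => /esym/eqP; rewrite mulf_eq0 /= => /eqP ->.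
    by exists 0; rewrite raddf0 mulr0z.
  have /dvdzP[e ->] := v_orth t (omega i) _ d0 (esym tE).
  rewrite mulrA mulrC => /(mulfI (isT : (2 : int) != 0)) <-.
  by have [a aE] := bd i; exists (a *~ e); rewrite raddfMz aE -mulrzA.
have [gamma [eta [_ gam_bd gam_id]]] := @poincare_inverse _ _ _ C_poincare
  (m + 1) (m - 1) (m + 1 + 1) m m ltac:(lia) erefl ltac:(lia) ltac:(lia).
have [w wE] := gam_id u; have [w' w'E] := gam_bd y.
have uE : u = codif (m + 1) (w' + w).
  by rewrite [LHS]wE -/c -cE w'E cu raddf0 addr0 codifD.
exists (v - (w' + w) *+ 2); first by rewrite codifD codifN codifMn -uE vu subrr.
exists 0, (- (w' + w)).
by rewrite codif0 add0r mulNrn addrAC subrr add0r.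
Qed.

(** In coordinates for d : C_(2k+1) -> C_2k, [omega i] is a cocycle when [delta i] is
    0, so N divides this coordinate of phi_0 z; the other coordinates belong to
    chains that have a multiple among the boundaries.  Hence phi_0 z is N times a
    cycle plus torsion, and duality transfers this to z. *)
Lemma phi0_unimodular z (N : int) : codif (m + 1) z = 0 -> N != 0 ->
  (forall z', codif (m + 1) z' = 0 -> (N %| ev 0 z z')%Z) ->
  exists z' (M : int) (w : coch (m - 1)),
    [/\ codif (m + 1) z' = 0, M != 0 & M *: (z - N *: z') = codif m w].
Proof.
move=> cz N0 z_div; pose c : C m := phi 0%N m m z.
have [n [beta [omega [delta [coord im bd]]]]] :=
  smith_coordinates (dif C (m + 1) m) (C_projective _) (C_projective _).
pose M := \prod_(i | delta i != 0) delta i.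
have M0 : M != 0 by apply/prodf_neq0.
pose c' := \sum_(i | delta i == 0) beta i *~ (omega i c %/ N)%Z.
pose s := \sum_(i | delta i != 0) beta i *~ omega i c.
have cE : c = c' *~ N + s.
  rewrite [LHS]coord (bigID (fun i => delta i == 0)) /= -/s; congr (_ + _).
  rewrite /c' mulrz_suml; apply: eq_bigr => i /eqP d0; rewrite -mulrzA divzK//.
  apply: (z_div (omega i)); apply/homP => a; apply/eqP; rewrite -dvd0z -d0.
  exact: im.
have [y yE] : exists y, dif C (m + 1) m y = s *~ M.
  rewrite /s mulrz_suml; apply: dif_sum => i di; have [a aE] := bd i.
  exists (a *~ ((\prod_(j | (delta j != 0) && (j != i)) delta j) * omega i c)).
  have -> : M = delta i * \prod_(j | (delta j != 0) && (j != i)) delta j.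
    by rewrite /M (bigD1 i).
  by rewrite raddfMz aE -!mulrzA; congr (_ *~ _); ring.
have dc : dif C m (m - 1) c = 0.
  have [n' [beta' [omega' [_ [coord' _ _]]]]] :=
    @smith_coordinates _ _ \0 (C_projective (m - 1)) (C_projective (m - 1)).
  rewrite [LHS]coord' big1// => i _.
  have -> : omega' i (dif C m (m - 1) c) = 0 :> int.
    by rewrite -[LHS]/(ev 0 z (codif m (omega' i))) phi0_codifr cz tensor_ev0l.
  exact: mulr0z.
have ds : dif C m (m - 1) s = 0.
  apply: (fg_projective_torsion_free (C_projective _) M0).
  by rewrite -raddfMz -yE dif_dif.
have dc' : dif C m (m - 1) c' = 0.
  apply: (fg_projective_torsion_free (C_projective _) N0).
  by rewrite -raddfMz; move: dc; rewrite cE raddfD ds addr0.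
have [gamma [eta [gam_cyc gam_bd gam_id]]] := @poincare_inverse _ _ _ C_poincare
  m m (m + 1) (m + 1) (m - 1) ltac:(lia) erefl erefl erefl.
have [w wE] := gam_id z; have [w' w'E] := gam_bd y.
exists (gamma c'), M, (w' + M *: w); split=> //; first exact: gam_cyc.
have zE : z - N *: gamma c' = gamma s + codif m w.
  rewrite [X in X - _]wE -/c cE cz raddf0 addr0 raddfD raddfMz scale_intz.
  by rewrite addrAC [X in X + _]addrAC subrr add0r.
by rewrite zE scalerDr codifD codifZ -w'E yE raddfMz scale_intz.
Qed.

Lemma phi0_torsion z t (w : coch (m - 1)) (N : int) : codif (m + 1) z = 0 ->
  N != 0 -> N *: t = codif m w -> ev 0 z t = 0.
Proof.
move=> cz N0 tE; apply: (mulfI N0); rewrite mulr0 -tensor_evZr tE.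
by rewrite phi0_codifr cz tensor_ev0l.
Qed.

Lemma torsion_cocycle t (w : coch (m - 1)) (N : int) :
  N != 0 -> N *: t = codif m w -> codif (m + 1) t = 0.
Proof.
by move=> N0 tE; apply: (scaleI N0); rewrite -codifZ tE codif_codif scaler0.
Qed.
End Duality.

(** * The form on cohomology modulo torsion *)

Section FreePart.
Variables (C : chain_complex) (k : nat) (phi : symmetric_structure (4 * k%:Z) C).
Hypothesis C_projective : forall r : int, fg_projective (C r).
Hypothesis C_poincare : poincare phi.
Local Notation m := (2 * k%:Z).
Local Notation ev s a b := (tensor_ev (phi s%N) a b).
Local Notation coch r := (cochain C int r).
Local Notation H := (H_free C k).
Implicit Types (x y : H) (z t : coch m) (a N : int).

Definition free_class (c : cocycle C int m) : H :=
  \pi_(mod_torsion (cohomology C int m))%qT (cohom_class c).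

Lemma free_classD c c' : free_class (c + c') = free_class c + free_class c'.
Proof.
rewrite /free_class.
have -> : cohom_class (c + c') = cohom_class c + cohom_class c' by exact: raddfD.
exact: raddfD.
Qed.


Lemma free_class0 : free_class 0 = 0.
Proof. by apply: (addrI (free_class 0)); rewrite -free_classD !addr0. Qed.

Lemma free_classN c : free_class (- c) = - free_class c.
Proof. by apply: (addrI (free_class c)); rewrite -free_classD !subrr free_class0. Qed.

Lemma free_classZ a c : free_class (a *: c) = a *: free_class c.
Proof.
have nat_mul n : free_class (c *+ n) = free_class c *+ n.
  elim: n => [|n IH]; first by rewrite mulr0n [RHS]mulr0n free_class0.
  by rewrite mulrS [RHS]mulrS free_classD IH.
rewrite !scale_intz; case: a => n.
  by rewrite -!pmulrn nat_mul.
by rewrite NegzE !mulrNz -!pmulrn free_classN nat_mul.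
Qed.

Lemma cohom_classZ a (c : cocycle C int m) :
  cohom_class (a *: c) = a *: cohom_class c.
Proof.
rewrite !scale_intz.
exact: (raddfMz (\pi_(cohomology C int m)%qT : {additive _ -> _})).
Qed.

Lemma free_class_eq0 c : free_class c = 0 <->
  exists N, N != 0 /\ exists w : coch (m - 1), N *: cocycle_val c = codif m w.
Proof.
rewrite -free_class0; split.
  move=> /lquot_eqP; rewrite -[_ \in _]/(`[< _ >] : bool) => /asboolP[N N0].
  have -> : cohom_class c - cohom_class 0 = cohom_class c.
    by rewrite [cohom_class 0](_ : _ = 0) ?subr0//; exact: raddf0.
  have <- : cohom_class (0 : cocycle C int m) = 0 by exact: raddf0.
  rewrite -cohom_classZ => /cohom_class_eqP[w /= wE].
  by exists N; split=> //; exists w; rewrite wE add0r.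
move=> [N [N0 [w wE]]]; apply/lquot_eqP/asboolP; exists N => //.
have -> : cohom_class c - cohom_class 0 = cohom_class c.
  by rewrite [cohom_class 0](_ : _ = 0) ?subr0//; exact: raddf0.
have <- : cohom_class (0 : cocycle C int m) = 0 by exact: raddf0.
by rewrite -cohom_classZ; apply/cohom_class_eqP; exists w; rewrite /= wE add0r.
Qed.

(** The integral analogue of [lifts]. *)
Definition free_lifts x z := exists c, free_class c = x /\ cocycle_val c = z.

Lemma free_lifts_rep x : free_lifts x (free_rep x).
Proof.
exists (repr (repr x : cohomology C int m)); split=> //.
by rewrite /free_class /cohom_class !reprK.
Qed.

Lemma free_lifts_cocycle x z : free_lifts x z -> codif (m + 1) z = 0.
Proof. by move=> [c [_ <-]]; apply/eqP; have := cocycleP c. Qed.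

Lemma cocycle_free_lifts z : codif (m + 1) z = 0 -> exists x, free_lifts x z.
Proof.
move=> cz; have cP : z \in @cocycle_pred C int m by rewrite inE cz.
by exists (free_class (Cocycle cP)), (Cocycle cP).
Qed.

Lemma free_lifts0 z : free_lifts 0 z <-> codif (m + 1) z = 0 /\
  exists N, N != 0 /\ exists w : coch (m - 1), N *: z = codif m w.
Proof.
split=> [xz|[cz tz]]; first split; first exact: free_lifts_cocycle xz.
  by move: xz => [c [/free_class_eq0 h <-]].
have [x [c [_ cE]]] := cocycle_free_lifts cz; exists c; split=> //.
by apply/free_class_eq0; rewrite cE.
Qed.

Lemma free_liftsD x y z t : free_lifts x z -> free_lifts y t -> free_lifts (x + y) (z + t).
Proof. by move=> [c [<- <-]] [c' [<- <-]]; exists (c + c'); rewrite free_classD. Qed.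

Lemma free_liftsZ a x z : free_lifts x z -> free_lifts (a *: x) (a *: z).
Proof. by move=> [c [<- <-]]; exists (a *: c); rewrite free_classZ. Qed.

Lemma free_lifts00 : free_lifts 0 0.
Proof. by exists 0; rewrite free_class0. Qed.

Lemma free_lifts_sum n (c : 'rV[int]_n) (g : 'I_n -> H) (f : 'I_n -> coch m) :
  (forall i, free_lifts (g i) (f i)) ->
  free_lifts (\sum_i c 0 i *: g i) (\sum_i c 0 i *: f i).
Proof.
move=> h; elim/big_rec2: _ => [|i x z _ IH]; first exact: free_lifts00.
by apply: free_liftsD => //; exact: free_liftsZ.
Qed.

Lemma free_liftsB x z t : free_lifts x z -> free_lifts x t -> free_lifts 0 (z - t).
Proof.
move=> xz xt; rewrite -[0](subrr x) -scaleN1r -[- t]scaleN1r.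
exact/free_liftsD/free_liftsZ.
Qed.

Lemma free_lifts_eq x y z : free_lifts x z -> free_lifts y z -> x = y.
Proof.
move=> [c [<- cE]] [c' [<- cE']]; congr free_class; apply: val_inj.
by rewrite /= cE.
Qed.

Lemma phi0_free_torsion z t : codif (m + 1) z = 0 -> free_lifts 0 t ->
  ev 0 z t = 0 /\ ev 0 t z = 0.
Proof.
move=> cz /free_lifts0[ct [N [N0 [w wE]]]].
have h := phi0_torsion phi cz N0 wE; split=> //.
by rewrite phi0_sym h ct cz tensor_ev0r tensor_ev0l !addr0.
Qed.

Lemma free_formE x y z t : free_lifts x z -> free_lifts y t ->
  free_form phi x y = ev 0 z t.
Proof.
move=> xz yt; rewrite /free_form.
have xz' := free_lifts_rep x; have yt' := free_lifts_rep y.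
have [_ h1] := phi0_free_torsion (free_lifts_cocycle yt') (free_liftsB xz' xz).
have [h2 _] := phi0_free_torsion (free_lifts_cocycle xz) (free_liftsB yt' yt).
move: h1 h2; rewrite tensor_evDl tensor_evNl tensor_evDr tensor_evNr.
by move=> /eqP; rewrite subr_eq0 => /eqP -> /eqP; rewrite subr_eq0 => /eqP.
Qed.

Lemma free_torsion_free a x : a != 0 -> a *: x = 0 -> x = 0.
Proof.
move=> a0 ax; have xz := free_lifts_rep x.
have := free_liftsZ a xz; rewrite ax => /free_lifts0[_ [N [N0 [w wE]]]].
apply: (free_lifts_eq xz); apply/free_lifts0; split.
  exact: free_lifts_cocycle xz.
by exists (N * a); rewrite mulf_neq0//; split=> //; exists w; rewrite -scalerA.
Qed.

(** The [omega i] with [delta i] = 0 generate the cocycles: a cocycle vanishes on the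
    other [beta i], which have a nonzero multiple among the boundaries. *)
Lemma free_has_basis : exists (n : nat) (e : 'I_n -> H), is_basis e.
Proof.
have [n [beta [omega [delta [coord im bd]]]]] :=
  smith_coordinates (dif C (m + 1) m) (C_projective _) (C_projective _).
pose f i : coch m := if delta i == 0 then omega i else 0.
have cf i : codif (m + 1) (f i) = 0.
  rewrite /f; case: eqP => [d0|_]; last exact: codif0.
  by apply/homP => a; apply/eqP; rewrite -dvd0z -d0; exact: im.
have /choice[g gP] := fun i => cocycle_free_lifts (cf i).
apply: (generated_has_basis (g := g) int_row_completable) => [a x|x].
  exact: free_torsion_free.
have xz := free_lifts_rep x; set z := free_rep x in xz.
have cz := free_lifts_cocycle xz.
exists (\row_i z (beta i)); apply: (free_lifts_eq xz).
have zE : \sum_i (\row_i z (beta i)) 0 i *: f i = z.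
  apply/homP => y; rewrite [in RHS](coord y) raddf_sum hom_sumE.
  apply: eq_bigr => i _; rewrite homZE mxE raddfMz /f.
  case: eqP => [_|/eqP d0]; first by rewrite -[RHS]mulrzr intz.
  have [a aE] := bd i.
  have : z (beta i) *~ delta i = 0.
    by rewrite -raddfMz -aE -[LHS]/(codif (m + 1) z a) cz.
  move=> /eqP; rewrite mulrz_eq0 (negbTE d0) /= => /eqP ->.
  by rewrite mul0rz scale0r.
by have := free_lifts_sum (\row_i z (beta i)) gP; rewrite zE.
Qed.
End FreePart.

(** * The Brown-Kervaire sum *)

Section FiniteQuadratic.
Variables (R : realType) (W : finZmodType).
Variables (lambda : W -> W -> 'F_2) (q : W -> 'Z_4).
Hypothesis lambda_sym : forall x y, lambda x y = lambda y x.
Hypothesis lambdaD : forall x y z, lambda x (y + z) = lambda x y + lambda x z.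
Hypothesis qD : forall x y, q (x + y) = q x + q y + (lambda x y : nat)%:R *+ 2.

Definition i_pow (a : 'Z_4) : R[i] := 'i%C ^+ (a : nat).

Lemma i_prim : 4.-primitive_root ('i%C : R[i]).
Proof.
rewrite -cis_pihalf (_ : pi / 2 = 2 * pi / 4%:R); last by field.
exact: cis_primitive.
Qed.

Lemma i_powE (a : int) : i_pow a%:~R = 'i%C ^ a.
Proof.
have i4 n : i_pow n%:R = 'i%C ^+ n.
  by rewrite /i_pow val_Zp_nat// -(expr_mod n (prim_expr_order i_prim)).
case: a => n; rewrite ?NegzE -?pmulrn ?i4// mulrNz -pmulrn.
have iD (a b : 'Z_4) : i_pow (a + b) = i_pow a * i_pow b.
  by rewrite /i_pow -exprD -[RHS](expr_mod _ (prim_expr_order i_prim)).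
have : i_pow (- n.+1%:R) * i_pow n.+1%:R = 1 by rewrite -iD addNr /i_pow expr0.
rewrite i4 -invr_expz -exprnP => /(canRL (mulfK _)) -> //; rewrite ?mul1r//.
by rewrite expf_neq0// -cis_pihalf cis_neq0.
Qed.

Lemma i_powD (a b : 'Z_4) : i_pow (a + b) = i_pow a * i_pow b.
Proof. by rewrite /i_pow -exprD -[RHS](expr_mod _ (prim_expr_order i_prim)). Qed.

Definition sign2 (a : 'F_2) : R[i] := (-1) ^+ (a : nat).

Lemma sign2D a b : sign2 (a + b) = sign2 a * sign2 b.
Proof. by rewrite /sign2 -exprD -[RHS]signr_odd -modn2. Qed.

Lemma sign2_eq1 a : (sign2 a == 1) = (a == 0).
Proof.
case: a => -[|[|//]] lt2; rewrite /sign2 -val_eqE /= ?eqxx//.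
by rewrite expr1 eqNr oner_eq0.
Qed.

Lemma i_pow_double (a : 'F_2) : i_pow ((a : nat)%:R *+ 2) = sign2 a.
Proof.
have -> : (a : nat)%:R = ((a : nat)%:Z)%:~R :> 'Z_4 by rewrite -pmulrn.
by rewrite mulr2n i_powD i_powE -exprnP -expr2 -exprM mulnC exprM sqr_i.
Qed.

Definition i_q x := i_pow (q x).

Lemma i_qD x y : i_q (x + y) = i_q x * i_q y * sign2 (lambda x y).
Proof. by rewrite /i_q qD i_powD i_pow_double i_powD. Qed.

Lemma i_q_conj x : i_q x * (i_q x)^*%C = 1.
Proof. by rewrite /i_q /i_pow -cis_pihalf -cisMn -cisN cisMcisN. Qed.

(** The summand of indices s + t and s is i^q(t) (-1)^lambda(t, s).  Summing over s
    first leaves only t = 0, because [lambda] is nondegenerate. *)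
Lemma i_q_norm : (forall x, (forall y, lambda x y = 0) -> x = 0) ->
  (\sum_x i_q x) * (\sum_x i_q x)^*%C = #|W|%:R.
Proof.
move=> nondeg.
have l0 x : lambda x 0 = 0 by apply: (addIr (lambda x 0)); rewrite -lambdaD !add0r.
have q0 : i_q 0 = 1.
  have := i_qD 0 0; rewrite addr0 l0 /sign2 expr0 mulr1 => /eqP.
  rewrite -{1}[i_q 0]mulr1 (inj_eq (mulfI _)) => [/eqP//|].
  apply/eqP => e; have := i_q_conj 0; rewrite e mul0r => /eqP.
  by rewrite eq_sym oner_eq0.
rewrite rmorph_sum mulr_sumr.
transitivity (\sum_t i_q t * \sum_(s in [set: W]) sign2 (lambda t s)).
  transitivity (\sum_s \sum_t i_q t * sign2 (lambda t s)).
    apply: eq_bigr => s _; rewrite mulr_suml (reindex_inj (addrI s)) /=.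
    by apply: eq_bigr => t _; rewrite addrC i_qD mulrAC -[i_q t * _ * _]mulrA i_q_conj mulr1.
  rewrite exchange_big /=; apply: eq_bigr => t _; rewrite -mulr_sumr.
  by congr (_ * _); apply: eq_bigl => s; rewrite inE.
have sgn_sum t : \sum_(s in [set: W]) sign2 (lambda t s) = if t == 0 then #|W|%:R else 0.
  rewrite (@character_sum _ _ [set: W] (fun s => sign2 (lambda t s))).
  - rewrite finset.cardsT; case: eqVneq => [->|t0].
      case: ifP => // /forall_inP[] s _.
      by rewrite lambda_sym l0 sign2_eq1.
    case: ifP => // /forall_inP h; case/eqP: t0; apply: nondeg => s.
    by apply/eqP; rewrite -sign2_eq1 h// inE.
  - by move=> s s' _ _; rewrite inE.
  - by move=> s s' _ _; rewrite lambdaD sign2D.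
rewrite (bigD1 0)//= q0 mul1r sgn_sum eqxx big1 ?addr0// => t t0.
by rewrite sgn_sum (negbTE t0) mulr0.
Qed.
End FiniteQuadratic.

Section Mod2Form.
Variables (C : chain_complex) (k : nat) (phi : symmetric_structure (4 * k%:Z) C).
Hypothesis C_projective : forall r : int, fg_projective (C r).
Hypothesis C_poincare : poincare phi.
Local Notation m := (2 * k%:Z).
Local Notation V := (H_mod2 C k).
Local Notation lambda := (@mod2_form C k phi).
Implicit Types x y : V.

(** A class is determined by the values at the [beta i] of its chosen cocycle, so
    there are finitely many classes, and they all serve as generators. *)
Lemma mod2_has_basis : exists (n : nat) (e : 'I_n -> V), is_basis e.
Proof.
have [n [beta [omega [_ [coord _ _]]]]] :=
  @smith_coordinates _ _ \0 (C_projective m) (C_projective m).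
pose val_at x i : 'F_2 := cocycle_val (repr (x : cohomology C 'F_2 m)) (beta i).
pose g (j : 'I_#|{: 'rV['F_2]_n}|) : V :=
  xget 0 [set x | forall i, val_at x i = enum_val j 0 i]%classic.
apply: (generated_has_basis (g := g) (@field_row_completable 'F_2)) => [a x a0 ax|x].
  by rewrite -[x](scalerK a0) ax scaler0.
pose j := enum_rank (\row_i val_at x i).
have gx : g j = x.
  have : forall i, val_at (g j) i = enum_val j 0 i.
    apply: (@xgetPex _ 0 [set x | forall i, val_at x i = enum_val j 0 i]%classic).
    by exists x => i; rewrite enum_rankK mxE.
  rewrite enum_rankK => h.
  have : cocycle_val (repr (g j : cohomology C 'F_2 m)) =
      cocycle_val (repr (x : cohomology C 'F_2 m)).
    apply/homP => y; rewrite (coord y) !raddf_sum; apply: eq_bigr => i _.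
    by rewrite !raddfMz; congr (_ *~ _); have := h i; rewrite mxE.
  by move/val_inj => e; rewrite -[g j](reprK) -[x in RHS](reprK) e.
exists (delta_mx 0 j); rewrite (bigD1 j)//= big1 => [|i ij].
  by rewrite mxE !eqxx scale1r addr0 gx.
by rewrite mxE (negbTE ij) scale0r.
Qed.

Lemma mod2_form0r x : lambda x 0 = 0.
Proof.
by apply: (addIr (lambda x 0)); rewrite -(mod2_formDr phi C_projective) !add0r.
Qed.

Lemma mod2_form_linear x : linear (lambda x : V -> ('F_2)^o).
Proof.
move=> a y z; rewrite (mod2_formDr phi C_projective); congr (_ + _).
have nat_mul n : lambda x (y *+ n) = lambda x y *+ n.
  elim: n => [|n IH]; first by rewrite mulr0n [RHS]mulr0n mod2_form0r.
  by rewrite mulrS [RHS]mulrS (mod2_formDr phi C_projective) IH.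
by rewrite -[a in LHS]natr_Zp scaler_nat nat_mul -mulr_natl natr_Zp.
Qed.

Lemma mod2_form_nondegenerate x : (forall y, lambda x y = 0) -> x = 0.
Proof.
move=> x0; have [v xv] := lifts_ex C_projective x.
apply: (lifts_eq xv); apply: lifts0.
apply: (mod2_nondegenerate C_projective C_poincare (lifts_cocycle xv)) => w cw.
have [y yw] := mod2_cocycle_lifts cw.
by rewrite -intr_F2_eq0 -(mod2_formE phi C_projective xv yw) x0.
Qed.

(** In a basis f of V, x |-> (lambda(x, f_i))_i is injective by nondegeneracy, and
    bijective because V is finite. *)
Lemma mod2_form_nonsingular : nonsingular_symmetric lambda.
Proof.
have sym := mod2_form_sym phi C_projective.
split=> [x y|x|f]; [exact: sym|exact: mod2_form_linear|].
have [n [e [h eK hK]]] := mod2_has_basis.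
have lambdaBl x y z : lambda (x - y) z = lambda x z - lambda y z.
  by rewrite sym -[- y]scaleN1r addrC mod2_form_linear scaleN1r ![lambda z _]sym addrC.
have inj x y : lambda x = lambda y -> x = y.
  move=> xy; apply/eqP; rewrite -subr_eq0; apply/eqP/mod2_form_nondegenerate => z.
  by rewrite lambdaBl xy subrr.
pose vec (c : 'rV['F_2]_n) : V := \sum_i c 0 i *: e i.
have lin_sum (l : V -> 'F_2) c : linear (l : V -> ('F_2)^o) ->
    l (vec c) = \sum_i c 0 i * l (e i).
  move=> lin; rewrite /vec; elim/big_rec2: _ => [|i s u _ <-]; last exact: lin.
  have := lin (-1) 0 0; rewrite scaler0 addr0 => ->.
  by rewrite scaleN1r addNr.
have ext (l l' : V -> 'F_2) : linear (l : V -> ('F_2)^o) ->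
    linear (l' : V -> ('F_2)^o) -> (forall i, l (e i) = l' (e i)) -> l = l'.
  move=> lin lin' ll'; apply/funext => y; rewrite -[y]hK -/(vec _) !lin_sum//.
  by apply: eq_bigr => i _; rewrite ll'.
pose T (c : 'rV['F_2]_n) := \row_i lambda (vec c) (e i).
have /injF_bij[T' _ T'K] : injective T.
  move=> c c' cc'; apply: (can_inj eK); apply: inj.
  apply: ext => [||i]; try exact: mod2_form_linear.
  by have := congr1 (fun r : 'rV_n => r 0 i) cc'; rewrite !mxE.
pose x0 := vec (T' (\row_i f (e i))).
have x0f : lambda x0 = f.
  apply: ext => [||i]; [exact: mod2_form_linear|exact: linearP|].
  have := congr1 (fun r : 'rV_n => r 0 i) (T'K (\row_i f (e i))).
  by rewrite !mxE.
by exists x0; split=> // y fy; apply: inj; rewrite fy.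
Qed.
End Mod2Form.

HB.instance Definition _ (U V : finZmodType) := GRing.Zmodule.on (U * V)%type.

Section BrownSum.
Variables (R : realType) (C : chain_complex) (k : nat).
Variable phi : symmetric_structure (4 * k%:Z) C.
Hypothesis C_projective : forall r : int, fg_projective (C r).
Hypothesis C_poincare : poincare phi.
Local Notation m := (2 * k%:Z).
Local Notation ev s a b := (tensor_ev (phi s%N) a b).
Local Notation coch r := (cochain C int r).
Local Notation V := (H_mod2 C k).
Local Notation H := (H_free C k).

Definition gram (b : nat) (e : 'I_b -> H) : 'M[int]_b :=
  \matrix_(i, j) free_form phi (e i) (e j).

Lemma free_form_sym (x y : H) : free_form phi x y = free_form phi y x.
Proof.
rewrite /free_form phi0_sym (free_lifts_cocycle (free_lifts_rep x)).
by rewrite (free_lifts_cocycle (free_lifts_rep y)) tensor_ev0l tensor_ev0r !addr0.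
Qed.

Lemma gram_sym b (e : 'I_b -> H) : (gram e)^T = gram e.
Proof. by apply/matrixP => i j; rewrite !mxE free_form_sym. Qed.

Lemma tensor_ev_sumr (p q : int) s (a : coch p) (I : finType) (F : I -> coch q) :
  ev s a (\sum_i F i) = \sum_i ev s a (F i).
Proof. exact: hom_sumE. Qed.

Lemma gramE b (e : 'I_b -> H) (w : 'rV[int]_b) z :
  free_lifts (\sum_i w 0 i *: e i) z ->
  (forall j, ev 0 z (free_rep (e j)) = (w *m gram e) 0 j) /\
  ev 0 z z = bform (gram e) w w.
Proof.
move=> wz; set x := \sum_i w 0 i *: e i in wz.
have Dr y : free_form phi y x = \sum_i w 0 i * free_form phi y (e i).
  have yy := free_lifts_rep y.
  rewrite (free_formE phi yy (free_lifts_sum w (fun i => free_lifts_rep (e i)))).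
  rewrite tensor_ev_sumr; apply: eq_bigr => i _.
  by rewrite (free_formE phi yy (free_lifts_rep (e i))).
have h j : ev 0 z (free_rep (e j)) = (w *m gram e) 0 j.
  rewrite -(free_formE phi wz (free_lifts_rep (e j))) free_form_sym Dr mxE.
  by apply: eq_bigr => i _; rewrite mxE free_form_sym.
split=> //; rewrite -(free_formE phi wz wz) Dr /bform mxE.
apply: eq_bigr => j _.
by rewrite (free_formE phi wz (free_lifts_rep (e j))) h mulrC [w^T j 0]mxE.
Qed.

(** The criterion [unimodularP], by [phi0_unimodular]. *)
Lemma gram_unimodular b (e : 'I_b -> H) : is_basis e -> exists A, gram e *m A = 1%:M.
Proof.
move=> [h eK hK]; apply: unimodularP => N x N0 x_div.
pose z : coch m := \sum_i x 0 i *: free_rep (e i).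
have xz : free_lifts (\sum_i x 0 i *: e i) z.
  by apply: free_lifts_sum => i; exact: free_lifts_rep.
have [zE _] := gramE xz; have cz := free_lifts_cocycle xz.
have z_div (z' : coch m) : codif (m + 1) z' = 0 -> (N %| ev 0 z z')%Z.
  move=> cz'; have [y yz'] := cocycle_free_lifts cz'.
  pose t : coch m := \sum_i (h y) 0 i *: free_rep (e i).
  have yt : free_lifts y t.
    by rewrite -[y]hK; apply: free_lifts_sum => i; exact: free_lifts_rep.
  rewrite -(free_formE phi xz yz') (free_formE phi xz yt) tensor_ev_sumr.
  by apply: rpred_sum => i _; rewrite tensor_evZr zE dvdz_mull.
have [z' [M [w [cz' M0 zz']]]] :=
  phi0_unimodular C_projective C_poincare cz N0 z_div.
have [y yz'] := cocycle_free_lifts cz'.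
have xNy : \sum_i x 0 i *: e i = N *: y.
  have h0 : free_lifts 0 (z - N *: z').
    apply/free_lifts0; split; first by rewrite codifD codifN codifZ cz cz' scaler0 subr0.
    by exists M; split=> //; exists w.
  apply: (free_lifts_eq xz); rewrite -[z](subrK (N *: z')) -[N *: y]add0r.
  by apply: free_liftsD => //; exact: free_liftsZ.
have xE : x = N *: h y.
  apply: (can_inj eK); rewrite xNy -{1}[y]hK scaler_sumr.
  by apply: eq_bigr => i _; rewrite scalerA mxE.
by move=> j; rewrite xE mxE dvdz_mulr.
Qed.

Variables (n : nat) (f : 'I_n -> V).
Hypothesis f_basis : is_basis f.
Let vec (r : 'rV['F_2]_n) : V := \sum_i r 0 i *: f i.
Let lam r s := mod2_form phi (vec r) (vec s).
Let q r := pontryagin_square phi (vec r).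

Lemma vecD r s : vec (r + s) = vec r + vec s.
Proof. by rewrite /vec -big_split; apply: eq_bigr => i _; rewrite mxE scalerDl. Qed.

Lemma vec_surj x : exists r, vec r = x.
Proof. by have [h _ hK] := f_basis; exists (h x); exact: hK. Qed.

(** K consists of the reductions of torsion cocycles, and J pairs the reduction of an
    integral cocycle z with the image under p of the coordinates w of its class
    modulo torsion.  The sum over V is the sum over the orthogonal of K, that is,
    over the first projection of J, and i^q(z) = i^(phi_0(z, z)) = i^(w B w^T). *)
Lemma brown_sum_phase (sigma : int) : is_signature (free_form phi) sigma ->
  has_phase (pi / 4 * sigma%:~R : R) (\sum_r i_pow R (q r)).
Proof.
move=> [b [e [P /= [e_basis Pu Ddiag sigmaE]]]].
have [A BA] := gram_unimodular e_basis.
have BE : \matrix_(i, j) (free_form phi (e i) (e j))%:~R = map_mx intr (gram e) :> 'M[rat]_b.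
  by apply/matrixP => i j; rewrite !mxE.
rewrite BE in Ddiag sigmaE.
have [G [p [chi [chiE h]]]] :=
  unimodular_gauss_sum_rat R (gram_sym e) BA Pu Ddiag sigmaE.
have vec0 : vec 0 = 0 by apply: (addIr (vec 0)); rewrite -vecD !add0r.
have vecN r : vec (- r) = - vec r by apply: (addIr (vec r)); rewrite -vecD !addNr.
pose K : {set 'rV['F_2]_n} := [set r | `[< exists t (w : coch (m - 1)) (N : int),
  [/\ N != 0, N *: t = codif m w & lifts (vec r) t] >]].
have K0 : 0 \in K.
  rewrite finset.in_set; apply/asboolP; exists 0, 0, 1; split=> //.
    by rewrite scaler0 codif0.
  rewrite vec0; apply: lifts0; exists 0, 0.
  by rewrite codif0 mul0rn addr0.
have KB : {in K &, forall s t, s - t \in K}.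
  move=> r s; rewrite ![_ \in K]finset.in_set.
  move=> /asboolP[t [w [N [N0 tE rt]]]] /asboolP[t' [w' [N' [N'0 tE' st']]]].
  apply/asboolP; exists (t - t'), (N' *: w - N *: w'), (N * N').
  split; first by rewrite mulf_neq0.
    rewrite codifD codifN !codifZ -tE -tE' !scalerA scalerBr.
    by rewrite [N' * N]mulrC.
  by rewrite vecD vecN; apply: liftsD => //; exact: liftsN.
rewrite (@isotropic_sum _ _ K _ (fun r s => sign2 R (lam r s))) => //; first last.
- by move=> r s t _ _; rewrite /lam vecD (mod2_formDr phi C_projective) sign2D.
- move=> r s; rewrite finset.in_set => /asboolP[t [w [N [N0 tE st]]]].
  rewrite /q vecD (pontryagin_enhancement phi C_projective) i_powD i_pow_double i_powD.
  have ct := torsion_cocycle N0 tE.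
  rewrite (pontryagin_squareE phi C_projective st) /pontryagin_form ct tensor_ev0r.
  by rewrite (phi0_torsion phi ct N0 tE) addr0 i_powE expr0z mulr1.
pose J : {set 'rV['F_2]_n * G} := [set x | `[< exists (z : coch m) (w : 'rV_b),
  [/\ lifts (vec x.1) z, free_lifts (\sum_i w 0 i *: e i) z & x.2 = p w] >]].
have JP x : reflect (exists (z : coch m) (w : 'rV_b),
  [/\ lifts (vec x.1) z, free_lifts (\sum_i w 0 i *: e i) z & x.2 = p w]) (x \in J).
  by rewrite finset.in_set; exact: asboolP.
have [he eK hK] := e_basis.
(* The orthogonal of K is the set of reductions of integral cocycles. *)
rewrite (eq_bigl [in fst @: J]) => [|r]; last first.
  apply/forall_inP/imsetP => [r_orth|[x /JP[z [w [xz wz _]]] -> s]].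
    have [v rv] := lifts_ex C_projective (vec r).
    have [z cz zv] : exists2 z, codif (m + 1) z = 0 & mod2_coboundary (z - v).
      apply: (torsion_orthogonal_integral C_projective C_poincare (lifts_cocycle rv)).
      move=> t w N N0 tE; have ct := torsion_cocycle N0 tE.
      have [y yt] : exists y, lifts y t.
        by apply: mod2_cocycle_lifts; exists 0; rewrite ct mul0rn.
      have [s sy] := vec_surj y.
      have /r_orth : s \in K.
        by rewrite finset.in_set; apply/asboolP; exists t, w, N; rewrite sy.
      rewrite sign2_eq1 /lam sy (mod2_formE phi C_projective rv yt).
      by rewrite intr_F2_eq0.
    have [y yz] := cocycle_free_lifts cz.
    exists (r, p (he y)) => //; apply/JP; exists z, (he y); split=> //=.
      by rewrite -[z](subrK v) addrC; exact: lifts_coboundaryD.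
    by rewrite hK.
  rewrite finset.in_set => /asboolP[t [w' [N [N0 tE st]]]].
  rewrite sign2_eq1 /lam (mod2_formE phi C_projective xz st).
  by rewrite (phi0_torsion phi (free_lifts_cocycle wz) N0 tE).
apply: (@correspondence_phase R _ ('rV['F_2]_n * G)%type 'rV['F_2]_n G J fst snd
  (fun r => i_pow R (q r)) chi).
- apply/JP; exists 0, 0; split; rewrite ?vec0 ?raddf0//=.
    by apply: lifts0; exists 0, 0; rewrite codif0 mul0rn addr0.
  by rewrite big1 => [|i _]; [exact: free_lifts00|rewrite mxE scale0r].
- move=> x y /JP[z [w [xz wz xp]]] /JP[z' [w' [yz wz' yp]]].
  apply/JP; exists (z - z'), (w - w'); split=> /=.
  + by rewrite vecD vecN; apply: liftsD => //; exact: liftsN.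
  + have -> : \sum_i (w - w') 0 i *: e i =
        \sum_i w 0 i *: e i + (-1) *: \sum_i w' 0 i *: e i.
      rewrite scaleN1r -sumrB; apply: eq_bigr => i _.
      by rewrite !mxE scalerBl.
    by rewrite -[- z']scaleN1r; apply: free_liftsD => //; exact: free_liftsZ.
  + by rewrite raddfB xp yp.
- move=> x /JP[z [w [xz wz xp]]] /=; rewrite xp chiE /q.
  rewrite (pontryagin_squareE phi C_projective xz) i_powE.
  rewrite /pontryagin_form (free_lifts_cocycle wz) tensor_ev0r addr0.
  by rewrite (gramE wz).2.
rewrite (eq_bigl (fun x => `[< exists w, x = p w >]))// => g.
apply/imsetP/asboolP => [[x /JP[z [w [_ _ xp]]] ->]|[w ->]]; first by exists w.
pose z : coch m := \sum_i w 0 i *: free_rep (e i).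
have wz : free_lifts (\sum_i w 0 i *: e i) z.
  by apply: free_lifts_sum => i; exact: free_lifts_rep.
have [y yz] : exists y, lifts y z.
  by apply: mod2_cocycle_lifts; exists 0; rewrite (free_lifts_cocycle wz) mul0rn.
have [r ry] := vec_surj y.
by exists (r, p w) => //; apply/JP; exists z, w; rewrite /= ry.
Qed.
End BrownSum.

Lemma fsum_bij (F : nmodType) (I : finType) (V : choiceType) (h : I -> V) (g : V -> F) :
  bijective h -> \sum_(x \in [set: V]%classic) g x = \sum_i g (h i).
Proof.
move=> hb; rewrite (reindex_fsbigT h)// [RHS]fsbig_seq ?index_enum_uniq//.
by apply: eq_fsbigl; apply/seteqP; split=> i //= _; rewrite mem_index_enum.
Qed.

Lemma cis_int_period (R : realType) (j : int) : cis (2 * pi * j%:~R : R) = 1.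
Proof.
have nat_case n : cis (2 * pi * n%:R : R) = 1 by rewrite mulr_natr cisMn cis_2pi expr1n.
case: j => n; first exact: nat_case.
by rewrite NegzE mulrNz mulrN cisN -pmulrn nat_case rmorph1.
Qed.

Lemma cis_Z8 (R : realType) (s : int) :
  cis (2 * pi * ((s%:~R : 'Z_8) : nat)%:R / 8 : R) = cis (pi / 4 * s%:~R).
Proof.
set a := (s%:~R : 'Z_8); have /dvdzP[j jE] : (8 %| s - (a : nat)%:Z)%Z.
  by rewrite -(@intr_Zp_eq0 8)// intrB -pmulrn natr_Zp subrr.
have sE : s%:~R = (a : nat)%:R + 8 * j%:~R :> R.
  rewrite -[s](subrK (a : nat)%:Z) jE intrD intrM -pmulrn addrC mulrC.
  by congr (_ + _ * _).
have -> : pi / 4 * s%:~R = 2 * pi * (a : nat)%:R / 8 + 2 * pi * j%:~R :> R.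
  by rewrite sE; field.
by rewrite cisD cis_int_period mulr1.
Qed.

Lemma cis_Z8_inj (R : realType) (a b : 'Z_8) :
  cis (2 * pi * (a : nat)%:R / 8 : R) = cis (2 * pi * (b : nat)%:R / 8) -> a = b.
Proof.
have E (c : 'Z_8) : cis (2 * pi * (c : nat)%:R / 8 : R) = cis (2 * pi / 8%:R) ^+ c.
  by rewrite -cisMn -[X in _ = cis X]mulr_natr mulrAC.
rewrite !E => /eqP; rewrite (eq_prim_root_expr (@cis_primitive R 8 isT)).
by rewrite !modn_small// => /eqP /val_inj.
Qed.

Section Final.
Variables (R : realType) (C : chain_complex) (k : nat).
Variable phi : symmetric_structure (4 * k%:Z) C.
Hypothesis C_projective : forall r : int, fg_projective (C r).
Hypothesis C_poincare : poincare phi.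

Lemma signatureP : is_signature (free_form phi) (signature phi).
Proof.
have [b [e eb]] := @free_has_basis C k C_projective.
have Bsym : (map_mx intr (gram phi e) : 'M[rat]_b)^T = map_mx intr (gram phi e).
  by rewrite map_trmx gram_sym.
have two0 : (2 : rat) != 0 by [].
have [P Pu Pd] := symmetric_diagonalizable two0 Bsym.
apply: (@xgetPex _ 0 [set sigma | is_signature (free_form phi) sigma]%classic).
have BE : \matrix_(i, j) (free_form phi (e i) (e j))%:~R
    = map_mx intr (gram phi e) :> 'M[rat]_b by apply/matrixP => i j; rewrite !mxE.
by exists (\sum_i sgz ((P^T *m map_mx intr (gram phi e) *m P) i i)), b, e, P; rewrite BE.
Qed.

Lemma brown_kervaireP : is_brown_kervaire R (mod2_form phi)
  (pontryagin_square phi) (signature phi)%:~R.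
Proof.
have nons := mod2_form_nonsingular C_projective C_poincare.
have enh := pontryagin_enhancement phi C_projective.
split=> //; have [n [f fb]] := @mod2_has_basis C k C_projective.
exists n, f; split=> //; rewrite (fsum_bij _ fb) cis_Z8.
have [r r0 rE] := brown_sum_phase R C_projective C_poincare fb signatureP.
pose vec (c : 'rV['F_2]_n) := \sum_i c 0 i *: f i.
have vecD r1 r2 : vec (r1 + r2) = vec r1 + vec r2 := vecD f r1 r2.
have vec0 : vec 0 = 0 by apply: (addIr (vec 0)); rewrite -vecD !add0r.
have card_W : #|{: 'rV['F_2]_n}|%:R = ((2 : R) ^+ n)%:C%C.
  by rewrite card_mx card_Fp// mul1n rmorphXn /= rmorph_nat natrX.
have r2 : r ^+ 2 = 2 ^+ n.
  apply: (@complexI R); rewrite -card_W.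
  rewrite -(@i_q_norm R 'rV['F_2]_n (fun x y => mod2_form phi (vec x) (vec y))
    (fun x => pontryagin_square phi (vec x))).
  - have conjE t : ((r%:C%C * cis t)^*)%C = r%:C%C * cis (- t).
      by rewrite cisN rmorphM /= oppr0.
    by rewrite /i_q rE conjE mulrACA cisMcisN mulr1 -rmorphM expr2.
  - by move=> x y; exact: mod2_form_sym.
  - by move=> x y z; rewrite vecD (mod2_formDr phi C_projective).
  - by move=> x y; rewrite vecD enh.
  - move=> x x0; apply: (bij_inj fb); rewrite -/(vec _) -/(vec _) vec0.
    apply: (mod2_form_nondegenerate C_projective C_poincare) => y.
    by have [h _ hK] := fb; rewrite -[y]hK x0.
rewrite [LHS]rE; congr (_ * _); rewrite -rmorphXn /=; congr (_%:C%C).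
apply/eqP; rewrite -(@eqrXn2 _ 2)// ?(ltW r0)// ?exprn_ge0 ?sqrtr_ge0//.
by rewrite r2 -exprM mulnC exprM sqr_sqrtr.
Qed.

Lemma BK_unique a b : is_brown_kervaire R (mod2_form phi) (pontryagin_square phi) a ->
  is_brown_kervaire R (mod2_form phi) (pontryagin_square phi) b -> a = b.
Proof.
move=> [_ _ [n [f [_ fE]]]] [_ _ [n' [f' [_ fE']]]]; apply: (@cis_Z8_inj R).
move: fE'; rewrite {}fE => e.
have normE j : `|(Num.sqrt (2 : R))%:C%C ^+ j| = (Num.sqrt 2)%:C%C ^+ j :> R[i].
  by rewrite ger0_norm// exprn_ge0// ler0c sqrtr_ge0.
have := congr1 (fun z : R[i] => `|z|) e; rewrite /= !normrM !norm_cis !mulr1 !normE => en.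
move: e; rewrite en => /(mulfI _) -> //.
rewrite expf_neq0// -(rmorph0 (@real_complex_def _ (Phant R))).
by rewrite (inj_eq (@complexI R)) gt_eqF// sqrtr_gt0.
Qed.
End Final.

Theorem theorem4p2p14 (R : realType) (C : chain_complex) (k : nat)
    (phi : symmetric_structure (4 * k%:Z) C)
    (C_projective : forall r : int, fg_projective (C r))
    (C_finite : finite_dimensional C)
    (phi_poincare : poincare phi) :
  [/\ nonsingular_symmetric (@mod2_form C k phi),
      quadratic_enhancement (@mod2_form C k phi) (@pontryagin_square C k phi)
    & (signature phi)%:~R
      = BK R (@mod2_form C k phi) (@pontryagin_square C k phi) :> 'Z_8].
Proof.
have BKP := brown_kervaireP R C_projective phi_poincare.
split.
- exact: mod2_form_nonsingular.
- exact: pontryagin_enhancement.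
apply: (BK_unique BKP).
apply: (@xgetPex _ 0 [set a | is_brown_kervaire R (mod2_form phi)
  (pontryagin_square phi) a]%classic).
by exists (signature phi)%:~R.
Qed.
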